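(* Let $\{X_t\}_{t\in\mathbb Z}$ be a strictly stationary, mean-zero functional time series in $L^2([0,1],\mathbb R)$ with spectral density kernel $f_\omega$. Let $(B_T)_{T\ge1}$ be positive numbers with $B_T\to0$ and $B_TT\to\infty$ as $T\to\infty$. Assume that $p\ge 1$ is the maximum integer value for which Condition $C(p,2)$ holds. Then one can choose an appropriate flat-top kernel $\Lambda$ of order $p$ (induced by a flat-top function $\lambda$) such that $$\mathbb E\big[\hat f^{(T)}_{\omega,\lambda}(\tau,\sigma)\big]=f_\omega(\tau,\sigma)+O(B_T^p)+O(B_T^{-1}T^{-1})\qquad (T\to\infty),$$ where the equality holds in $L^2$ and the error terms are uniform in $\omega$; that is, there is a constant $C$ such that for all sufficiently large $T$, $$\sup_{\omega\in\mathbb R}\big\|\mathbb E[\hat f^{(T)}_{\omega,\lambda}]-f_\omega\big\|_{L^2([0,1]^2)}\le C\,(B_T^p+B_T^{-1}T^{-1}).$$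
   Context: Setting: $\{X_t(\tau);\tau\in[0,1]\}_{t\in\mathbb Z}$ is a sequence of random elements of $L^2([0,1],\mathbb R)$, strictly stationary (for any finite $I\subset\mathbb Z$ and $s\in\mathbb Z$ the joint laws of $\{X_t,t\in I\}$ and $\{X_{t+s},t\in I\}$ agree), with $\mathbb E X_t(\tau)=0$ for all $\tau$. The autocovariance kernel is $r_t(\tau,\sigma)=\mathbb E[X_{t+s}(\tau)X_s(\sigma)]$, and the spectral density kernel is $f_\omega(\tau,\sigma)=\frac1{2\pi}\sum_{t\in\mathbb Z}e^{-i\omega t}r_t(\tau,\sigma)$. Cumulant condition: the $k$-th order cumulant kernel is $\mathrm{cum}(X_{t_1}(\tau_1),\dots,X_{t_k}(\tau_k))=\sum_{\nu=(\nu_1,\dots,\nu_q)}(-1)^{q-1}(q-1)!\prod_{l=1}^q\mathbb E\big[\prod_{j\in\nu_l}X_{t_j}(\tau_j)\big]$, the sum being over all unordered partitions $\nu$ of $\{1,\dots,k\}$. For $l\ge0$ and $k\ge2$, Condition $C(l,k)$ says: for each $j=1,\dots,k-1$, $\sum_{t_1,\dots,t_{k-1}=-\infty}^{\infty}(1+|t_j|^l)\,\|\mathrm{cum}(X_{t_1},\dots,X_{t_{k-1}},X_0)\|_2<\infty$, where $\|\cdot\|_2$ is the norm of $L^2([0,1]^k)$ (the moments needed to define these cumulants being assumed to exist). Flat-top kernels: a flat-top function is $\lambda:\mathbb R\to[-1,1]$ with $\lambda(s)=1$ for $|s|\le c$ and $\lambda(s)=g(s)$ otherwise, where $c>0$ and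 $g:\mathbb R\to[-1,1]$ is symmetric, continuous at all but finitely many points, $g(c)=1$ and $\int_{\mathbb R}g^2<\infty$. The induced flat-top kernel is $\Lambda(x)=\frac1{2\pi}\int_{-\infty}^\infty\lambda(s)e^{isx}\,ds$. A kernel $\Lambda$ is of order $q$ if its $q$-th moment $\int s^q\Lambda(s)\,ds$ exists and is finite and $\int s^k\Lambda(s)\,ds=0$ for all integers $1\le k\le q-1$. Estimator: given $X_0,\dots,X_{T-1}$, the functional discrete Fourier transform is $\tilde X^{(T)}_\omega(\tau)=(2\pi T)^{-1/2}\sum_{t=0}^{T-1}X_t(\tau)e^{-i\omega t}$ and the periodogram kernel is $p^{(T)}_\omega(\tau,\sigma)=\tilde X^{(T)}_\omega(\tau)\tilde X^{(T)}_{-\omega}(\sigma)$. The flat-top estimator is $\hat f^{(T)}_{\omega,\lambda}(\tau,\sigma)=\frac{2\pi}T\sum_{s=1}^{T-1}W^{(T)}_\lambda\big(\omega-\frac{2\pi s}T\big)p^{(T)}_{2\pi s/T}(\tau,\sigma)$ with $W^{(T)}_\lambda(x)=\sum_{j\in\mathbb Z}\frac1{B_T}\Lambda\big(\frac{x+2\pi j}{B_T}\big)$. *)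

(* Defs.v *)
From HB Require Import structures.
From mathcomp Require Import all_boot all_order all_algebra.
From mathcomp Require Import all_classical all_reals all_analysis.
From mathcomp Require Import complex.

Set Implicit Arguments.
Unset Strict Implicit.
Unset Printing Implicit Defensive.
Import Order.TTheory GRing.Theory Num.Theory.
Import numFieldNormedType.Exports.

Local Open Scope classical_set_scope.
Local Open Scope ring_scope.
Local Open Scope complex_scope.

Section UnitInterval.
Context {R : realType}.

(* A measure on the whole line, carried by [0,1]: kernels below are functions
   on R (resp. R * R, k.-tuple R) that only matter on the unit cube. *)
Definition leb01 : set (measurableTypeR R) -> \bar R :=
  mrestr lebesgue_measure (measurable_itv `[0%R, 1%R]).

HB.instance Definition _ := Measure.on leb01.

Let leb01_setT : leb01 setT = 1%E.
Proof.
by rewrite /leb01 /mrestr setTI lebesgue_measure_itv/= lte01 oppr0 adde0.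
Qed.

HB.instance Definition _ :=
  @Measure_isProbability.Build _ _ R leb01 leb01_setT.

Let consR k (z : measurableTypeR R * k.-tuple (measurableTypeR R)) :
  k.+1.-tuple (measurableTypeR R) := [the _.-tuple _ of z.1 :: z.2].

Let measurable_consR k : measurable_fun [set: _] (@consR k).
Proof. by apply: measurable_cons. Qed.

HB.instance Definition _ k :=
  @isMeasurableFun.Build _ _ _ _ (@consR k) (@measurable_consR k).

Fixpoint leb01_pow k : probability (k.-tuple (measurableTypeR R)) R :=
  if k is k'.+1 then
    distribution (leb01 \x leb01_pow k')%E (@consR k')
  else \d_[tuple of [::]].

End UnitInterval.

Section L2Space.
Context {R : realType}.

(* Representatives of the elements of L^2([0,1],R); [L2dist] is a pseudometric
   whose open sets are saturated for a.e. equality, so they are exactly the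
   preimages of the open sets of the quotient. *)
Definition L2fun := LfunType (@leb01 R) (lee1n 2).

HB.instance Definition _ := Choice.on L2fun.
HB.instance Definition _ :=
  isPointed.Build L2fun (0 : LfunType (@leb01 R) (lee1n 2)).

Definition L2dist (x y : L2fun) : \bar R :=
  'N[leb01]_2%:E [EFin \o (x \- y)].

Definition L2open : set (set L2fun) :=
  [set U | forall x, U x ->
    exists2 e : R, 0 < e & [set y | (L2dist x y < e%:E)%E] `<=` U].

Definition L2borel := g_sigma_algebraType L2open.

End L2Space.

Section TimeSeries.
Context {R : realType} {d : measure_display} {T : measurableType d}.
Variables (P : probability T R) (X : int -> T -> @L2fun R).

(* Random elements of L^2([0,1]), represented by jointly measurable functions
   of the sample point and of the argument, so that X_t(tau) makes sense. *)
Definition random_elements :=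
  forall t, measurable_fun [set: T] (X t : T -> @L2borel R) /\
    measurable_fun [set: T * measurableTypeR R] (fun z => X t z.1 z.2).

Definition joint n (t : n.-tuple int) : T -> n.-tuple (@L2borel R) :=
  fun w => [tuple (X (tnth t i) w : @L2borel R) | i < n].

Definition strictly_stationary :=
  forall n (t : n.-tuple int) (s : int) (A : set (n.-tuple (@L2borel R))),
    measurable A ->
    pushforward P (joint [tuple tnth t i + s | i < n]) A =
    pushforward P (joint t) A.

(* The mean is that of an element of L^2([0,1]): it vanishes for a.e. tau. *)
Definition mean_zero :=
  forall t, {ae (@leb01 R), forall tau,
    P.-integrable setT (fun w => (X t w tau)%:E) /\
    'E_P[fun w => X t w tau]%E = 0%E}.

(* r_t(tau,sigma) = E[X_{t+s}(tau) X_s(sigma)], taken at s = 0. *)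
Definition autocov (t : int) (tau sigma : R) : R :=
  fine 'E_P[(fun w => X t w tau * X 0 w sigma)%R]%E.

Definition mixed_prod k (t : 'I_k -> int) (tau : k.-tuple R) (B : {set 'I_k})
  : T -> R := fun w => \prod_(j in B) X (t j) w (tnth tau j).

Definition cumulant k (t : 'I_k -> int) (tau : k.-tuple R) : R :=
  \sum_(nu : {set {set 'I_k}} | finset.partition nu [set: 'I_k]%SET)
    (-1) ^+ #|nu|.-1 * (#|nu|.-1)`!%:R *
    \prod_(B in nu) fine 'E_P[mixed_prod t tau B]%E.

Definition cumulant_moments k :=
  forall t : 'I_k -> int, {ae (@leb01_pow R k), forall tau,
    forall B : {set 'I_k},
      P.-integrable setT (EFin \o mixed_prod t tau B)}.

(* Condition C(l,k), meant for k >= 2: [t] ranges over Z^(k-1) and is completed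
   by t_k = 0. *)
Definition cumulant_condition (l k : nat) :=
  cumulant_moments k /\
  forall j : 'I_k.-1,
    (\esum_(t in [set: k.-1.-tuple int])
       ((1 + `|tnth t j|%:~R ^+ l)%:E *
        'N[leb01_pow k]_2%:E
          [EFin \o cumulant (fun i : 'I_k => nth 0%R (rcons t 0%R) i)])
     < +oo)%E.

End TimeSeries.

Section Complex.
Context {R : realType}.

Definition cis (x : R) : R[i] := cos x +i* sin x.

Definition cintegrable d (T : measurableType d)
    (mu : {measure set T -> \bar R}) (f : T -> R[i]) :=
  mu.-integrable setT (EFin \o (fun x => complex.Re (f x))) /\
  mu.-integrable setT (EFin \o (fun x => complex.Im (f x))).

Definition cintegral d (T : measurableType d)
    (mu : {measure set T -> \bar R}) (f : T -> R[i]) : R[i] :=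
  (\int[mu]_x complex.Re (f x)) +i* (\int[mu]_x complex.Im (f x)).

(* Limit of the partial sums over |t| <= n. *)
Definition zsum (a : int -> R) : R :=
  limn (fun n : nat => \sum_(k < n.*2.+1) a (k%:Z - n%:Z)).

Definition czsum (a : int -> R[i]) : R[i] :=
  zsum (fun t => complex.Re (a t)) +i* zsum (fun t => complex.Im (a t)).

Definition czsummable (a : int -> R[i]) :=
  (\esum_(t in [set: int]) (ComplexField.Normc.normc (a t))%:E < +oo)%E.

(* [normc] is the modulus with values in R; [`|z|] would lie in R[i]. *)
Definition L2norm2 (h : R -> R -> R[i]) : \bar R :=
  'N[(leb01 \x leb01)%E]_2%:E
    [(fun z : measurableTypeR R * measurableTypeR R =>
        (ComplexField.Normc.normc (h z.1 z.2))%:E)].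

End Complex.

Section FlatTop.
Context {R : realType}.

Definition flat_top (lambda : R -> R) :=
  exists (c : R) (g : R -> R),
    [/\ 0 < c /\ g c = 1,
        forall s, -1 <= g s <= 1,
        forall s, g (- s) = g s,
        (exists2 E : set R, finite_set E &
           forall s, ~ E s -> {for s, continuous g}) /\
        (\int[lebesgue_measure]_s ((g s ^+ 2)%:E) < +oo)%E &
        forall s, lambda s = if `|s| <= c then 1 else g s].

Definition flat_top_kernel (lambda : R -> R) (x : R) : R[i] :=
  ((2 * pi)^-1)%:C *
  cintegral lebesgue_measure (fun s => (lambda s)%:C * cis (s * x)).

Definition kernel_order (Lambda : R -> R[i]) (q : nat) :=
  cintegrable lebesgue_measure (fun s => (s ^+ q)%:C * Lambda s) /\
  forall k, (0 < k < q)%N ->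
    cintegrable lebesgue_measure (fun s => (s ^+ k)%:C * Lambda s) /\
    cintegral lebesgue_measure (fun s => (s ^+ k)%:C * Lambda s) = 0.

Definition window_term (Lambda : R -> R[i]) (b x : R) (j : int) : R[i] :=
  (b^-1)%:C * Lambda ((x + 2 * pi * j%:~R) / b).

Definition window (Lambda : R -> R[i]) (b x : R) : R[i] :=
  czsum (window_term Lambda b x).

(* The integral defining Lambda and the series defining the windows W^(T)
   converge absolutely, so that neither takes a default value. *)
Definition admissible_flat_top (lambda : R -> R) :=
  [/\ flat_top lambda,
      lebesgue_measure.-integrable setT (EFin \o lambda) &
      forall b x, 0 < b -> czsummable (window_term (flat_top_kernel lambda) b x)].

End FlatTop.

Section Estimator.
Context {R : realType} {d : measure_display} {T : measurableType d}.
Variables (P : probability T R) (X : int -> T -> @L2fun R).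

Definition spectral_density (omega tau sigma : R) : R[i] :=
  ((2 * pi)^-1)%:C *
  czsum (fun t => cis (- (omega * t%:~R)) * (autocov P X t tau sigma)%:C).

Definition fdft (N : nat) (omega tau : R) (w : T) : R[i] :=
  ((Num.sqrt (2 * pi * N%:R))^-1)%:C *
  \sum_(0 <= t < N) (X t%:Z w tau)%:C * cis (- (omega * t%:R)).

Definition periodogram (N : nat) (omega tau sigma : R) (w : T) : R[i] :=
  fdft N omega tau w * fdft N (- omega) sigma w.

Definition flat_top_estimator (lambda : R -> R) (B : nat -> R) (N : nat)
    (omega tau sigma : R) (w : T) : R[i] :=
  (2 * pi / N%:R)%:C *
  \sum_(1 <= s < N)
    window (flat_top_kernel lambda) (B N) (omega - 2 * pi * s%:R / N%:R) *
    periodogram N (2 * pi * s%:R / N%:R) tau sigma w.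

Definition cexpectation (Z : T -> R[i]) : R[i] := cintegral P Z.

End Estimator.

(* Main.v *)
Require Import Defs.
From HB Require Import structures.
From mathcomp Require Import all_boot all_order all_algebra.
From mathcomp Require Import all_classical all_reals all_analysis.
From mathcomp Require Import complex ring lra zify measurable_realfun.

Set Implicit Arguments.
Unset Strict Implicit.
Unset Printing Implicit Defensive.
Import Order.TTheory GRing.Theory Num.Theory.
Import numFieldNormedType.Exports.

Local Open Scope classical_set_scope.
Local Open Scope ring_scope.

(* Take a flat-top function lambda supported in [-2,2] and smooth enough that its
   kernel is integrable with p moments, the positive ones vanishing.  By Poisson
   summation the window is then a finite cosine sum,
     W(x) = (2 pi)^-1 \sum_(|k| <= 2/b) lambda(bk) cos(kx),
   and orthogonality over the Fourier frequencies turns the expected estimator into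
   the average over t, u < N of (2 pi)^-1 lambda(b(t-u)) e^(-i omega (t-u)) r_(t-u),
   up to the missing frequency s = 0, the aliasing of the lags |t-u| > N/2, and the
   triangular factor 1 - |k|/N.  The missing frequency costs O(1/(bN)) per lag, and
   1 - lambda(bk) <= (b|k|)^p because lambda = 1 on [-1,1]; so the bias is at most
   O(b^p + 1/(bN)) * \sum_k (1 + |k|^p) |r_k|, at almost every (tau, sigma), and
   Minkowski's inequality turns this into the L^2 bound.

   Strict stationarity constrains the laws of the X_t on the Borel sets of L^2, where
   point evaluations make no sense.  It is applied to the continuous functionals
   f |-> \int_A trunc_n(f), which determine E[trunc_n X_i(tau) trunc_n X_j(sigma)] for
   a.e. (tau, sigma); then n goes to infinity. *)

(** * Symmetric partial sums over the integers *)

(** The ramp is piecewise polynomial so that every integral against it becomes that of a polynomial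
    times a cosine over [1,2], a family stable under integration by parts. Contact order p+2 at the
    junctions makes y^p Lambda(y) of order 1/(1 + y^2): p for the moment, 2 for its integrability.
    The weight 1 + |k|^p pays for each source of error: |k|^p for leaving the flat top, and |k| <=
    |k|^p for the lags beyond N/2 and for the triangular factor. All estimates are made at one pair
    (tau, sigma), relative to a number G that bounds the partial sums of (1 + |k|^p) |r_k|. The null
    set discarded depends neither on N nor on omega, hence the uniformity. Real and imaginary parts
    have the same form up to a phase pi/2, and each costs 17: 16 for the weights and 1 for the
    triangular factor. *)

Definition symsum (V : zmodType) (a : int -> V) (n : nat) : V :=
  \sum_(k < n.*2.+1) a (k%:Z - n%:Z).

Lemma symsum0 (V : zmodType) (a : int -> V) : symsum a 0 = a 0.
Proof. by rewrite /symsum big_ord1. Qed.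

Lemma symsumS (V : zmodType) (a : int -> V) n :
  symsum a n.+1 = symsum a n + (a n.+1%:Z + a (- n.+1%:Z)).
Proof.
rewrite /symsum doubleS big_ord_recl big_ord_recr /= /bump /= sub0r.
rewrite [RHS]addrA [RHS]addrC; congr (_ + _); congr (_ + _).
  by apply: eq_bigr => i _; congr a; rewrite /bump; lia.
by congr a; rewrite /bump; lia.
Qed.

Lemma eq_symsum (V : zmodType) (a b : int -> V) n :
  (forall m, (`|m| <= n)%N -> a m = b m) -> symsum a n = symsum b n.
Proof. by move=> ab; apply: eq_bigr => i _; apply: ab; have := ltn_ord i; lia. Qed.

Lemma symsumN (V : zmodType) (a : int -> V) n :
  symsum (fun k => a (- k)) n = symsum a n.
Proof.
elim: n => [|n IH]; first by rewrite !symsum0 oppr0.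
by rewrite !symsumS IH opprK [a (- _) + _]addrC.
Qed.

Lemma symsumB (V : zmodType) (a b : int -> V) n :
  symsum (fun k => a k - b k) n = symsum a n - symsum b n.
Proof. exact: sumrB. Qed.

Lemma symsumZ (V : pzRingType) (c : V) (a : int -> V) n :
  symsum (fun k => c * a k) n = c * symsum a n.
Proof. by rewrite /symsum mulr_sumr. Qed.

Lemma ler_symsum (V : numDomainType) (a b : int -> V) n :
  (forall m, (`|m| <= n)%N -> a m <= b m) -> symsum a n <= symsum b n.
Proof. by move=> ab; apply: ler_sum => i _; apply: ab; have := ltn_ord i; lia. Qed.

Lemma symsum_ge0 (V : numDomainType) (a : int -> V) n :
  (forall m, 0 <= a m) -> 0 <= symsum a n.
Proof. by move=> a0; apply: sumr_ge0. Qed.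

Lemma ler_symsum_norm (V : numDomainType) (a : int -> V) n :
  `|symsum a n| <= symsum (fun k => `|a k|) n.
Proof. exact: ler_norm_sum. Qed.

Lemma ler_symsum_widen (V : numDomainType) (a : int -> V) n m :
  (forall k, 0 <= a k) -> (n <= m)%N -> symsum a n <= symsum a m.
Proof.
move=> a0; elim: m => [|m IH]; first by rewrite leqn0 => /eqP ->.
rewrite leq_eqVlt => /predU1P[-> //|]; rewrite ltnS => /IH /le_trans; apply.
by rewrite symsumS lerDl addr_ge0.
Qed.

(* The sums over the hooks max(t,u) = m are the symmetric partial sums. *)
Lemma sum_sum_symsum (V : zmodType) (a : int -> V) n :
  \sum_(t < n) \sum_(u < n) a (t%:Z - u%:Z) = \sum_(m < n) symsum a m.
Proof.
elim: n => [|n IH]; first by rewrite !big_ord0.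
rewrite [RHS]big_ord_recr big_ord_recr /= -IH.
under eq_bigr do rewrite big_ord_recr /=.
rewrite big_split /= -addrA; congr (_ + _).
rewrite big_ord_recr /= subrr.
transitivity (\sum_(i < n) (a i.+1%:Z + a (- i.+1%:Z)) + a 0).
  rewrite big_split /= addrA [RHS]addrC addrC; congr (_ + _).
  rewrite addrC; congr (_ + _).
    rewrite (reindex_inj rev_ord_inj) /=; apply: eq_bigr => i _; congr a.
    by have := ltn_ord i; lia.
  rewrite (reindex_inj rev_ord_inj) /=; apply: eq_bigr => i _; congr a.
  by have := ltn_ord i; lia.
elim: n {IH} => [|n IH]; first by rewrite big_ord0 add0r symsum0.
by rewrite symsumS big_ord_recr /= -IH [RHS]addrAC.
Qed.

Lemma symsum_finite (V : zmodType) (a : int -> V) K n :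
  (forall m, (K < `|m|)%N -> a m = 0) -> (K <= n)%N -> symsum a n = symsum a K.
Proof.
move=> aK; elim: n => [|n IH]; first by rewrite leqn0 => /eqP ->.
rewrite leq_eqVlt => /predU1P[-> //|]; rewrite ltnS => Kn.
by rewrite symsumS IH// !aK ?addr0//; lia.
Qed.

(** * Integrals of continuous functions *)

Lemma Rintegral_sum d (T : measurableType d) (R : realType)
    (mu : {measure set T -> \bar R}) I (s : seq I) (D : set T) (f : I -> T -> R) :
  measurable D -> (forall i, mu.-integrable D (EFin \o f i)) ->
  \int[mu]_(x in D) (\sum_(i <- s) f i x) = \sum_(i <- s) \int[mu]_(x in D) f i x.
Proof.
move=> mD fi; elim: s => [|i s IH].
  by rewrite big_nil; under eq_Rintegral do rewrite big_nil; rewrite Rintegral_cst// mul0r.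
rewrite big_cons -IH; under eq_Rintegral do rewrite big_cons.
rewrite RintegralD//.
apply: (@eq_integrable _ _ _ mu D mD _ _ _
  (integrable_sum mD s (P := xpredT) (fun i _ => fi i))).
by move=> x _; rewrite /= sumEFin.
Qed.

Section IntegralsOfContinuousFunctions.
Context {R : realType}.
Implicit Types (f g F G : R -> R) (a b c : R).
Local Notation mu := (@lebesgue_measure R).

Lemma in_continuous_integrable f a b :
  {in `[a, b], continuous f} -> mu.-integrable `[a, b] (EFin \o f).
Proof.
move=> cf; apply: continuous_compact_integrable; first exact: segment_compact.
by apply: continuous_in_subspaceT => x /[1!inE]; exact: cf.
Qed.

Lemma continuous_itv_integrable f a b :
  continuous f -> mu.-integrable `[a, b] (EFin \o f).
Proof. by move=> cf; apply: in_continuous_integrable => x _; exact: cf. Qed.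

Lemma is_derive_LRcontinuous F f a b : a < b ->
  (forall x, a <= x <= b -> is_derive x 1 F (f x)) ->
  derivable_oo_LRcontinuous F a b.
Proof.
move=> ab dF; have cF x : a <= x <= b -> F y @[y --> x] --> F x.
  by move=> /dF [dFx _]; apply: differentiable_continuous; exact/derivable1_diffP.
split.
- by move=> x /[!in_itv]/= /andP[ax xb]; have [] := dF x; rewrite ?(ltW ax) ?(ltW xb).
- by apply: cvg_at_right_filter; apply: cF; rewrite lexx ltW.
- by apply: cvg_at_left_filter; apply: cF; rewrite lexx ltW.
Qed.

Lemma is_derive_derive1_in F f a b :
  (forall x, a <= x <= b -> is_derive x 1 F (f x)) -> {in `]a, b[, F^`()%classic =1 f}.
Proof.
move=> dF x /[!in_itv]/= /andP[ax xb]; rewrite derive1E.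
by have [|_ ->] := dF x; rewrite ?(ltW ax) ?(ltW xb).
Qed.

Lemma in_continuous_within f a b :
  {in `[a, b], continuous f} -> {within `[a, b], continuous f}.
Proof. by move=> cf; apply: continuous_in_subspaceT => x /[1!inE]; exact: cf. Qed.

Lemma Rintegral_FTC F f a b : a < b ->
  (forall x, a <= x <= b -> is_derive x 1 F (f x)) ->
  {in `[a, b], continuous f} ->
  \int[mu]_(x in `[a, b]) f x = F b - F a.
Proof.
move=> ab dF cf; rewrite /Rintegral (@continuous_FTC2 _ f F)//.
- exact: in_continuous_within.
- exact: is_derive_LRcontinuous dF.
- exact: is_derive_derive1_in.
Qed.

Lemma Rintegral_by_parts F G f g a b : a < b ->
  (forall x, a <= x <= b -> is_derive x 1 F (f x)) ->
  (forall x, a <= x <= b -> is_derive x 1 G (g x)) ->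
  {in `[a, b], continuous f} -> {in `[a, b], continuous g} ->
  \int[mu]_(x in `[a, b]) (F x * g x) =
  (F b * G b - F a * G a) - \int[mu]_(x in `[a, b]) (f x * G x).
Proof.
move=> ab dF dG cf cg; apply: Rintegration_by_parts => //.
- exact: in_continuous_within.
- exact: is_derive_LRcontinuous dF.
- exact: is_derive_derive1_in.
- exact: in_continuous_within.
- exact: is_derive_LRcontinuous dG.
- exact: is_derive_derive1_in.
Qed.

Lemma Rintegral_itv_split f a b c : a <= b -> b <= c -> continuous f ->
  \int[mu]_(x in `[a, c]) f x =
  \int[mu]_(x in `[a, b]) f x + \int[mu]_(x in `[b, c]) f x.
Proof.
move=> ab bc cf.
have -> : `[a, c]%classic = `[a, b[ `|` `[b, c].
  by rewrite -itv_bndbnd_setU// bnd_simp.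
rewrite Rintegral_setU//=.
- congr (_ + _); apply: Rintegral_itv_bndo_bndc.
  apply: integrableS (continuous_itv_integrable a b cf) => //.
  by apply: subset_itvl; rewrite bnd_simp.
- rewrite -itv_bndbnd_setU ?bnd_simp//.
  exact: continuous_itv_integrable.
- apply/disj_setPLR => x /=; rewrite !in_itv/= => /andP[_ xb]; apply/negP.
  by rewrite negb_and -ltNge xb.
Qed.

Lemma Rintegral_itv_nat_split f a h n : 0 <= h -> continuous f ->
  \int[mu]_(x in `[a, a + h * n%:R]) f x =
  \sum_(k < n) \int[mu]_(x in `[a + h * k%:R, a + h * k%:R + h]) f x.
Proof.
move=> h0 cf; elim: n => [|n IH].
  by rewrite big_ord0 mulr0 addr0 set_itv1 Rintegral_set1.
have -> : a + h * n.+1%:R = a + h * n%:R + h by rewrite -natr1 mulrDr mulr1 addrA.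
rewrite big_ord_recr /= -IH; apply: Rintegral_itv_split => //; last by rewrite lerDl.
by rewrite lerDl mulr_ge0.
Qed.

Lemma Rintegral_itvN f a b : a <= b -> continuous f ->
  \int[mu]_(x in `[- b, - a]) f x = \int[mu]_(x in `[a, b]) f (- x).
Proof.
move=> ab cf; rewrite /Rintegral integration_by_substitution_oppr//.
exact: continuous_subspaceT.
Qed.

Lemma Rintegral_itv_sym f b : 0 <= b -> continuous f ->
  \int[mu]_(x in `[- b, b]) f x = \int[mu]_(x in `[0, b]) (f x + f (- x)).
Proof.
move=> b0 cf; have cfN : continuous (fun x => f (- x)).
  by move=> x; apply: continuous_comp; [exact: opp_continuous|exact: cf].
rewrite (@Rintegral_itv_split _ _ 0)// ?oppr_le0// RintegralD//.
- by rewrite addrC -[in X in _ + X = _](oppr0 R) Rintegral_itvN.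
- exact: continuous_itv_integrable.
- exact: continuous_itv_integrable.
Qed.

Lemma le_normr_Rintegral_itv f a b c : a <= b ->
  {in `[a, b], continuous f} -> (forall x, a <= x <= b -> `|f x| <= c) ->
  `|\int[mu]_(x in `[a, b]) f x| <= c * (b - a).
Proof.
move=> ab cf fc; apply: le_trans (le_normr_Rintegral _ _) _ => //.
  exact: in_continuous_integrable.
have -> : c * (b - a) = \int[mu]_(x in `[a, b]) c.
  rewrite Rintegral_cst//= lebesgue_measure_itv/= lte_fin.
  by move: ab; rewrite le_eqVlt => /predU1P[->|->//]; rewrite ltxx subrr.
apply: le_Rintegral => //.
- apply: in_continuous_integrable => x xab.
  by apply: continuous_comp; [exact: cf|exact: norm_continuous].
- by apply: in_continuous_integrable => x xab; exact: cst_continuous.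
Qed.

Lemma continuous_sumr (I : Type) (r : seq I) (h : I -> R -> R) :
  (forall i, continuous (h i)) -> continuous (fun x => \sum_(i <- r) h i x).
Proof.
move=> ch; elim: r => [|i r IH].
  by under eq_fun do rewrite big_nil; exact: cst_continuous.
under eq_fun do rewrite big_cons.
by move=> x; apply: cvgD; [exact: ch|exact: IH].
Qed.

Lemma Rintegral_sum_continuous (I : Type) (r : seq I) (h : I -> R -> R) a b :
  (forall i, continuous (h i)) ->
  \int[mu]_(x in `[a, b]) (\sum_(i <- r) h i x) =
  \sum_(i <- r) \int[mu]_(x in `[a, b]) h i x.
Proof. by move=> ch; apply: Rintegral_sum => // i; exact: continuous_itv_integrable. Qed.

End IntegralsOfContinuousFunctions.

(** * The flat-top function and its kernel *)

Section Ramp.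
Context {R : realType}.
Implicit Types (s t x y theta : R) (p q : {poly R}).
Local Notation mu := (@lebesgue_measure R).

Definition clamp01 x : R := Num.min 1 (Num.max 0 x).

(* Equal to 1 on [-1,1] and to 0 outside [-2,2], with both junctions of contact order m:
   this gives m boundary-free integrations by parts. *)
Definition ramp m s : R := (1 - clamp01 (`|s| - 1) ^+ m) ^+ m.

(** Agrees with [ramp m] on [1,2] only; by evenness, and since the ramp is constant on [0,1] and
    beyond 2, this piece determines the whole function. *)
Definition ramp_poly m : {poly R} := (1 - ('X - 1) ^+ m) ^+ m.

Lemma clamp01P x : [\/ x <= 0 /\ clamp01 x = 0, 0 <= x <= 1 /\ clamp01 x = x |
  1 <= x /\ clamp01 x = 1].
Proof.
rewrite /clamp01; case: (leP 0 x) => x0; last first.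
  by apply: Or31; split; [lra|apply/min_idPr; lra].
case: (leP x 1) => x1; first by apply: Or32; split; [lra|].
by apply: Or33; split; [lra|].
Qed.

Lemma clamp01_itv x : 0 <= clamp01 x <= 1.
Proof. by case: (clamp01P x) => -[? ->]; lra. Qed.

Lemma clamp01_lipschitz x y : `|clamp01 x - clamp01 y| <= `|x - y|.
Proof.
by case: (clamp01P x) => -[? ->]; case: (clamp01P y) => -[? ->];
  case: (ger0P (x - y)) => xy; rewrite ?ler_norml; try (case: ger0P); lra.
Qed.

Lemma exprB_lipschitz m x y : 0 <= x <= 1 -> 0 <= y <= 1 ->
  `|x ^+ m - y ^+ m| <= m%:R * `|x - y|.
Proof.
move=> /andP[x0 x1] /andP[y0 y1]; rewrite subrXX normrM mulrC ler_wpM2r//.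
rewrite (le_trans (ler_norm_sum _ _ _))// -[leRHS]mulr1 mulr_natl.
rewrite -[X in _ *+ X]card_ord -sumr_const; apply: ler_sum => i _.
by rewrite normrM !normrX !ger0_norm// mulr_ile1 ?exprn_ge0 ?exprn_ile1.
Qed.

Lemma onem_expr_itv m x : 0 <= x <= 1 -> 0 <= 1 - x ^+ m <= 1.
Proof. by move=> /andP[x0 x1]; rewrite subr_ge0 exprn_ile1//= gerBl exprn_ge0. Qed.

Lemma ramp_itv m s : 0 <= ramp m s <= 1.
Proof.
have /andP[h0 h1] := onem_expr_itv m (clamp01_itv (`|s| - 1)).
by rewrite exprn_ge0//= exprn_ile1.
Qed.

Lemma rampN m s : ramp m (- s) = ramp m s.
Proof. by rewrite /ramp normrN. Qed.

(** One factor m for each of the two powers; [clamp01] and the absolute value are 1-Lipschitz. This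
    bound, valid across the junctions, is what the concentration of the Fejer kernel later relies
    on. *)
Lemma ramp_lipschitz m s t : `|ramp m s - ramp m t| <= (m * m)%:R * `|s - t|.
Proof.
have h x := onem_expr_itv m (clamp01_itv x).
rewrite /ramp (le_trans (exprB_lipschitz m (h _) (h _)))// natrM -mulrA.
rewrite ler_wpM2l// opprB [_ - _ + _]addrC addrA subrK distrC.
rewrite (le_trans (exprB_lipschitz _ (clamp01_itv _) (clamp01_itv _)))//.
rewrite ler_wpM2l// (le_trans (clamp01_lipschitz _ _))//.
by rewrite opprB addrA subrK ler_dist_dist.
Qed.

Lemma continuous_lipschitz (f : R -> R) (L : R) :
  (forall s t, `|f s - f t| <= L * `|s - t|) -> continuous f.
Proof.
move=> fL x; apply/cvgrPdist_lt => e e0.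
have L1 : 0 < `|L| + 1 by rewrite ltr_wpDl.
near=> y; apply: le_lt_trans (fL _ _) _.
apply: (@le_lt_trans _ _ ((`|L| + 1) * `|x - y|)).
  by rewrite ler_wpM2r// (le_trans (ler_norm _))// lerDl.
rewrite mulrC -ltr_pdivlMr//; near: y.
by apply: cvgr_dist_lt; [exact: cvg_id|rewrite divr_gt0].
Unshelve. all: by end_near. Qed.

Lemma continuous_ramp m : continuous (ramp m).
Proof. exact/continuous_lipschitz/ramp_lipschitz. Qed.

Lemma ramp_eq1 m s : (0 < m)%N -> `|s| <= 1 -> ramp m s = 1.
Proof.
move=> m0 s1; rewrite /ramp (_ : clamp01 _ = 0) ?expr0n ?gtn_eqF ?subr0 ?expr1n//.
by case: (clamp01P (`|s| - 1)) => -[? ->]; lra.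
Qed.

Lemma ramp_eq0 m s : (0 < m)%N -> 2 <= `|s| -> ramp m s = 0.
Proof.
move=> m0 s2; rewrite /ramp (_ : clamp01 _ = 1) ?expr1n ?subrr ?expr0n ?gtn_eqF//.
by case: (clamp01P (`|s| - 1)) => -[? ->]; lra.
Qed.

Lemma ramp_polyE m s : 1 <= s <= 2 -> ramp m s = (ramp_poly m).[s].
Proof.
move=> s12; rewrite /ramp /ramp_poly !hornerE.
congr ((1 - _ ^+ _) ^+ _); rewrite ger0_norm; last lra.
by case: (clamp01P (s - 1)) => -[? ->]; lra.
Qed.

(** Each derivative lowers the order of the zero at x by at most one. *)
Lemma derivn_horner_root k m q x :
  (k < m)%N -> ((('X - x%:P) ^+ m * q)^`(k)).[x] = 0.
Proof.
elim: k m q => [|k IH] [|m] // q; first by rewrite derivn0 !hornerE subrr expr0n mul0r.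
rewrite ltnS => km; rewrite derivSn derivM deriv_exp derivXsubC mul1r /=.
rewrite exprS mulrnAl -mulrnAr (_ : _ + _ =
  ('X - x%:P) ^+ m * (q *+ m.+1 + ('X - x%:P) * q^`())); last ring.
exact: IH.
Qed.

(** With z = (X - 1)^m, the difference (1 - z)^m - 1 is divisible by z: near 1 the polynomial is
    constant up to order m. *)
Lemma derivn_ramp_poly1 m k : (0 < k < m)%N -> (ramp_poly m)^`(k).[1] = 0.
Proof.
move=> /andP[k0 km].
have [q qE] : exists q, ramp_poly m = 1 + ('X - 1%:P) ^+ m * q.
  rewrite polyC1 /ramp_poly; set z := ('X - 1) ^+ m.
  exists (- \sum_(i < m) (1 - z) ^+ i).
  rewrite -[LHS](subrK 1) subrX1 addrC; congr (_ + _); ring.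
rewrite qE derivnD hornerD derivn_horner_root// addr0.
by rewrite derivn_poly0 ?horner0// size_polyC oner_eq0.
Qed.

(** 1 - (X - 1)^m vanishes at 2, so it has the factor X - 2, and its m-th power has a zero of order
    m there. *)
Lemma derivn_ramp_poly2 m k : (k < m)%N -> (ramp_poly m)^`(k).[2] = 0.
Proof.
move=> km.
have [q ->] : exists q, ramp_poly m = ('X - 2%:P) ^+ m * q.
  exists ((- \sum_(i < m) ('X - 1) ^+ i) ^+ m).
  rewrite -exprMn /ramp_poly; congr (_ ^+ _).
  rewrite -opprB subrX1 mulrN; congr (- (_ * _)).
  by rewrite -addrA -opprD -polyC1 -polyCD.
exact: derivn_horner_root.
Qed.

Lemma horner_bound p : {M : R | forall s, 0 <= s <= 2 -> `|p.[s]| <= M}.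
Proof.
exists (\sum_(i < size p) `|p`_i| * 2 ^+ i) => s /andP[s0 s2].
rewrite horner_coef (le_trans (ler_norm_sum _ _ _))//.
apply: ler_sum => i _; rewrite normrM ler_wpM2l// normrX lerXn2r ?nnegrE//.
by rewrite ger0_norm.
Qed.

(** The phase absorbs the change of cosine into sine: an integration by parts differentiates p and
    adds pi/2 to theta, so multiplication by y stays in the family up to boundary terms. *)
Definition polycos p y theta : R :=
  \int[mu]_(s in `[1, 2]) (p.[s] * cos (s * y + theta)).

Lemma is_derive_sin_affine y theta s :
  is_derive s 1 (fun s : R => sin (s * y + theta)) (cos (s * y + theta) * y).
Proof.
apply: (@trigger_derive _ _ _ (cos (s * y + theta) *: (y : R))) => //.
have -> : (fun s => sin (s * y + theta)) = (@sin R) \o (fun s => s * y + theta) by [].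
apply: is_derive1_comp.
apply: (@trigger_derive _ (id * cst y + cst theta) _ (s *: (0 : R) + y *: (1 : R) + 0)).
by rewrite scaler0 add0r addr0 /GRing.scale/= mulr1.
Qed.

Lemma continuous_cos_affine y theta : continuous (fun s : R => cos (s * y + theta)).
Proof.
move=> s; apply: (@continuous_comp _ _ _ (fun s : R => s * y + theta) (@cos R)).
  by apply: cvgD; [apply: cvgMl; exact: cvg_id|exact: cvg_cst].
exact: continuous_cos.
Qed.

Lemma continuous_sin_affine y theta : continuous (fun s : R => sin (s * y + theta)).
Proof.
move=> s; apply: (@continuous_comp _ _ _ (fun s : R => s * y + theta) (@sin R)).
  by apply: cvgD; [apply: cvgMl; exact: cvg_id|exact: cvg_cst].
exact: continuous_sin.
Qed.

Lemma polycos_by_parts p y theta :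
  y * polycos p y theta = p.[2] * sin (2 * y + theta) - p.[1] * sin (y + theta)
    + polycos p^`() y (theta + pi / 2).
Proof.
have cpc q th : continuous (fun s => q.[s] * cos (s * y + th)).
  by move=> s; apply: cvgM; [exact: continuous_horner|exact: continuous_cos_affine].
rewrite /polycos -RintegralZl//; last exact: continuous_itv_integrable.
under eq_Rintegral do rewrite mulrC -mulrA.
have dp s : 1 <= s <= 2 -> is_derive s 1 (horner p) p^`().[s].
  by move=> _; exact: is_derive_poly.
have dsin s : 1 <= s <= 2 -> is_derive s 1 (fun s => sin (s * y + theta))
  (cos (s * y + theta) * y) by move=> _; exact: is_derive_sin_affine.
rewrite (Rintegral_by_parts _ dp dsin)//; last 3 first.
- lra.
- by move=> s _; exact: continuous_horner.
- by move=> s _; apply: cvgM; [exact: continuous_cos_affine|exact: cvg_cst].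
rewrite mul1r; congr (_ + _); rewrite -mulN1r -RintegralZl//; last first.
  apply: continuous_itv_integrable => s; apply: cvgM.
    exact: continuous_horner.
  exact: continuous_sin_affine.
by apply: eq_Rintegral => s _; rewrite addrA cosDpihalf; ring.
Qed.

Lemma polycos_bound p : {M : R | forall y theta, `|polycos p y theta| <= M}.
Proof.
have [M pM] := horner_bound p; exists M => y theta.
rewrite -[leRHS]mulr1 (_ : 1 = 2 - 1 :> R); last lra.
apply: le_normr_Rintegral_itv => [|s _|s /andP[s1 s2]]; first lra.
  by apply: cvgM; [exact: continuous_horner|exact: continuous_cos_affine].
rewrite normrM -[leRHS]mulr1 ler_pM ?cos_max// pM// s2 andbT; lra.
Qed.

End Ramp.

(** * Decay of the kernel of the ramp *)

Section RampKernel.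
Context {R : realType}.
Local Open Scope complex_scope.
Implicit Types (s t x y theta : R).
Local Notation mu := (@lebesgue_measure R).

Lemma cos_lipschitz x y : `|cos x - cos y| <= `|x - y|.
Proof.
wlog xy : x y / x <= y.
  by move=> h; case: (leP x y) => [|/ltW] /h//; rewrite distrC [leRHS]distrC.
rewrite distrC [leRHS]distrC.
have dcos t : t \in `]x, y[ -> is_derive t 1 (@cos R) (- sin t).
  by move=> _; exact: is_derive_cos.
have ccos : {within `[x, y], continuous (@cos R)}.
  exact/continuous_subspaceT/continuous_cos.
have [c _ ->] := MVT_segment xy dcos ccos.
by rewrite normrM normrN ler_piMl// sin_max.
Qed.

(** Real form of the kernel: the sine part vanishes because the ramp is even, and its support is
    [-2,2]. *)
Definition ramp_kernel m y : R :=
  (2 * pi)^-1 * \int[mu]_(s in `[-2, 2]) (ramp m s * cos (s * y)).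

Lemma Rintegral_supported (f : R -> R) (a b : R) :
  (forall x, x \notin `[a, b] -> f x = 0) ->
  \int[mu]_x f x = \int[mu]_(x in `[a, b]) f x.
Proof.
move=> f0; rewrite [RHS]Rintegral_mkcond; apply: eq_Rintegral => x _.
by rewrite patchE; case: ifPn => //; rewrite notin_setE => /negP/f0.
Qed.

Lemma continuous_ramp_cos m y theta :
  continuous (fun s => ramp m s * cos (s * y + theta)).
Proof.
by move=> s; apply: cvgM; [exact: continuous_ramp|exact: continuous_cos_affine].
Qed.

Lemma continuous_ramp_cos0 m y : continuous (fun s => ramp m s * cos (s * y)).
Proof.
by have := @continuous_ramp_cos m y 0; under eq_fun do rewrite addr0.
Qed.

Lemma continuous_ramp_sin m y : continuous (fun s => ramp m s * sin (s * y)).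
Proof.
have := @continuous_ramp_cos m y (- (pi / 2)).
by under eq_fun do rewrite cosBpihalf.
Qed.

Lemma ramp_supported m (f : R -> R) x :
  (0 < m)%N -> x \notin `[-2, 2] -> ramp m x * f x = 0.
Proof.
move=> m0; rewrite in_itv/= negb_and -!ltNge => x2.
by rewrite ramp_eq0 ?mul0r// ler_normr; case/orP: x2; lra.
Qed.

Lemma flat_top_kernel_ramp m y : (0 < m)%N ->
  flat_top_kernel (ramp m) y = (ramp_kernel m y)%:C.
Proof.
move=> m0; rewrite /flat_top_kernel /cintegral.
have -> : (fun s => complex.Re ((ramp m s)%:C * cis (s * y))) =
    (fun s => ramp m s * cos (s * y)).
  by apply/funext => s; rewrite /= mul0r subr0.
have -> : (fun s => complex.Im ((ramp m s)%:C * cis (s * y))) =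
    (fun s => ramp m s * sin (s * y)).
  by apply/funext => s; rewrite /= mul0r addr0.
rewrite !(@Rintegral_supported _ (-2) 2); last 2 first.
- by move=> x; exact: (@ramp_supported m (fun s => sin (s * y))).
- by move=> x; exact: (@ramp_supported m (fun s => cos (s * y))).
rewrite [X in _ +i* X]Rintegral_itv_sym//; last exact: continuous_ramp_sin.
under [X in _ +i* X]eq_Rintegral do rewrite rampN mulNr sinN mulrN subrr.
by rewrite Rintegral_cst// mul0r -rmorphM.
Qed.

Lemma pi_ramp_kernel m y : (0 < m)%N ->
  pi * ramp_kernel m y =
  \int[mu]_(s in `[0, 1]) cos (s * y) + polycos (ramp_poly m) y 0.
Proof.
move=> m0; have cr := @continuous_ramp_cos0 m y.
rewrite /ramp_kernel Rintegral_itv_sym//.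
under eq_Rintegral do rewrite rampN mulNr cosN -mulr2n -mulr_natl.
rewrite RintegralZl//; last exact: continuous_itv_integrable.
rewrite (@Rintegral_itv_split _ _ 0 1 2)//; [|lra..].
have pi0 : pi != 0 :> R by rewrite gt_eqF// pi_gt0.
have piK (z : R) : pi * ((2 * pi)^-1 * (2 * z)) = z.
  by rewrite invfM [2^-1 * _]mulrC -mulrA mulVKf// mulKf.
rewrite piK; congr (_ + _).
  apply: eq_Rintegral => s; rewrite inE/= in_itv/= => /andP[s0 s1].
  by rewrite ramp_eq1 ?mul1r// ger0_norm.
apply: eq_Rintegral => s; rewrite inE/= in_itv/= => s12.
by rewrite ramp_polyE// addr0.
Qed.

(** This is k integrations by parts. In the first, the boundary term - sin y at s = 1 cancels the
    sin y produced by the flat part, and the one at s = 2 vanishes with the ramp. In the later ones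
    all boundary terms vanish by contact of order m. *)
Lemma expr_ramp_kernel m k y : (0 < k <= m)%N ->
  y ^+ k * ramp_kernel m y = pi^-1 * polycos (ramp_poly m)^`(k) y (k%:R * (pi / 2)).
Proof.
have pi0 : pi != 0 :> R by rewrite gt_eqF// pi_gt0.
case: k => // k /= km; apply: (mulfI pi0); rewrite mulrCA [RHS]mulrA mulfV// mul1r.
have m0 : (0 < m)%N by apply: leq_trans km.
elim: k km => [|k IH] km.
  rewrite expr1 pi_ramp_kernel// mulrDr polycos_by_parts mul1r add0r addr0.
  rewrite -(@ramp_polyE _ m 2) ?ramp_eq0//; [|by rewrite ger0_norm|lra].
  rewrite -(@ramp_polyE _ m 1) ?ramp_eq1//; [|by rewrite normr1|lra].
  rewrite mul0r sub0r mul1r addr0 derivn0 addrA.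
  rewrite -RintegralZl//; last first.
    apply: continuous_itv_integrable.
    by have := @continuous_cos_affine R y 0; under eq_fun do rewrite addr0.
  have dsin s : 0 <= s <= 1 -> is_derive s 1 (fun s => sin (s * y)) (y * cos (s * y)).
    move=> _; have := is_derive_sin_affine y 0 s.
    by under eq_fun do rewrite addr0; rewrite addr0 mulrC.
  rewrite (Rintegral_FTC _ dsin)//.
    by rewrite mul1r mul0r sin0 subr0 subrr add0r.
  move=> s _; apply: cvgM; first exact: cvg_cst.
  have := @continuous_cos_affine R y 0; under eq_fun do rewrite addr0.
  by apply.
rewrite exprS -mulrA (IH (ltnW km)) -derivnS.
rewrite polycos_by_parts derivn_ramp_poly1 ?km// derivn_ramp_poly2//.
by rewrite !mul0r subr0 add0r -[k.+2%:R]natr1 [in RHS]mulrDl mul1r.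
Qed.

Lemma expr_ramp_kernel_bound m k : (0 < m)%N -> (k <= m)%N ->
  {M : R | forall y, `|y ^+ k * ramp_kernel m y| <= M}.
Proof.
move=> m0; case: k => [_|k km].
  exists ((2 * pi)^-1 * (1 * (2 - -2))) => y; rewrite expr0 mul1r normrM.
  rewrite ger0_norm ?invr_ge0 ?mulr_ge0 ?pi_ge0//.
  rewrite ler_wpM2l ?invr_ge0 ?mulr_ge0 ?pi_ge0//.
  apply: le_normr_Rintegral_itv => [|s _|s _]; first lra.
    exact: continuous_ramp_cos0.
  have /andP[r0 r1] := ramp_itv m s.
  by rewrite normrM ger0_norm// mulr_ile1// cos_max.
have [M hM] := @polycos_bound R (derivn k.+1 (ramp_poly m)).

exists (pi^-1 * M) => y; rewrite expr_ramp_kernel// normrM.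
by rewrite ger0_norm ?invr_ge0 ?pi_ge0// ler_wpM2l ?invr_ge0 ?pi_ge0.
Qed.

(** The bounds for the exponents k and k+2 add up to one for (1 + y^2) |y^k Lambda(y)|. *)
Lemma ramp_kernel_decay m k : (k.+2 <= m)%N ->
  {M : R | 0 <= M & forall y, `|y ^+ k * ramp_kernel m y| <= M / (1 + y ^+ 2)}.
Proof.
move=> km.
have m0 : (0 < m)%N by apply: leq_trans km.
have [M1 h1] := expr_ramp_kernel_bound m0 (ltnW (ltnW km)).
have [M2 h2] := expr_ramp_kernel_bound m0 km.
exists (M1 + M2) => [|y].
  apply: addr_ge0; [exact: le_trans (normr_ge0 _) (h1 0)|].
  exact: le_trans (normr_ge0 _) (h2 0).
have y1 : 0 < 1 + y ^+ 2 by rewrite ltr_pwDl// sqr_ge0.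
rewrite ler_pdivlMr// mulrDr mulr1 lerD//.
rewrite -[X in _ * X]ger0_norm ?sqr_ge0// -normrM mulrC mulrA -exprD.
exact: h2.
Qed.

Lemma continuous_ramp_kernel m : continuous (ramp_kernel m).
Proof.
(* The 8 is 2 * 4: |s| <= 2 on an interval of length 4. *)
apply: (@continuous_lipschitz _ _ ((2 * pi)^-1 * 8)) => x y.
rewrite /ramp_kernel -mulrBr normrM ger0_norm ?invr_ge0 ?mulr_ge0 ?pi_ge0//.
rewrite -mulrA ler_wpM2l ?invr_ge0 ?mulr_ge0 ?pi_ge0//.
have cr z := @continuous_ramp_cos0 m z.
rewrite -RintegralB//; [|exact: continuous_itv_integrable..].
rewrite (_ : 8 * _ = 2 * `|x - y| * (2 - -2)); last lra.
apply: le_normr_Rintegral_itv => [|s _|s /andP[s1 s2]]; first lra.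
  by apply: cvgB; exact: cr.
have /andP[r0 r1] := ramp_itv m s.
rewrite -mulrBr normrM ger0_norm// (le_trans (ler_piMl _ r1))//.
rewrite (le_trans (cos_lipschitz _ _))// -mulrBr normrM ler_wpM2r//.
by rewrite ler_norml; lra.
Qed.

Lemma integrable_oneDsqrV :
  mu.-integrable setT (EFin \o (fun x : R => (1 + x ^+ 2)^-1)).
Proof.
apply/integrableP; split.
  apply/measurable_EFinP; apply: continuous_measurable_fun.
  exact: continuous_oneDsqrV.
under eq_integral do rewrite /= ger0_norm ?invr_ge0 ?addr_ge0 ?sqr_ge0//.
rewrite ge0_symfun_integralT.
- rewrite -set_itvcy integral0y_oneDsqr -EFinM ltry//.
- by move=> x; rewrite invr_ge0 addr_ge0 ?sqr_ge0.
- exact: continuous_oneDsqrV.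
- by move=> x /=; rewrite sqrrN.
Qed.

Lemma integrable_expr_ramp_kernel m k : (k.+2 <= m)%N ->
  mu.-integrable setT (EFin \o (fun x : R => x ^+ k * ramp_kernel m x)).
Proof.
move=> km; have [M M0 hM] := ramp_kernel_decay km.
have iM := integrableZl measurableT M integrable_oneDsqrV.
apply: le_integrable iM => //.
  apply/measurable_EFinP; apply: continuous_measurable_fun => x.
  by apply: cvgM; [exact: exprn_continuous|exact: continuous_ramp_kernel].
move=> x _ /=; rewrite lee_fin (le_trans (hM x))// ger0_norm//.
by rewrite mulr_ge0// invr_ge0 addr_ge0// sqr_ge0.
Qed.

End RampKernel.

(** * Vanishing moments of the kernel *)

Lemma Rintegral_dominated_cvg d (T : measurableType d) (R : realType)
    (mu : {measure set T -> \bar R}) (f_ : nat -> T -> R) (f g : T -> R) :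
  (forall n, measurable_fun setT (f_ n)) -> measurable_fun setT f ->
  mu.-integrable setT (EFin \o g) ->
  {ae mu, forall x, f_ n x @[n --> \oo] --> f x} ->
  {ae mu, forall x, forall n, `|f_ n x| <= g x} ->
  \int[mu]_x f_ n x @[n --> \oo] --> \int[mu]_x f x.
Proof.
move=> mf_ mf ig f_f f_g.
have [||||intf _ cf] := @dominated_convergence _ _ _ mu setT measurableT
  (fun n => EFin \o f_ n) (EFin \o f) (EFin \o g) _ _ _ ig _.
- by move=> n; apply/measurable_EFinP.
- by apply/measurable_EFinP.
- move: f_f; apply: filterS => x cfx _.
  by apply/fine_cvgP; split; [near=> n|].
- by move: f_g; apply: filterS => x fgx n _; rewrite lee_fin.
apply: fine_cvg; rewrite fineK//; exact: integrable_fin_num.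
Unshelve. all: end_near. Qed.

Section RampMoments.
Context {R : realType}.
Local Open Scope complex_scope.
Implicit Types (s t x y theta : R) (p : {poly R}).
Local Notation mu := (@lebesgue_measure R).

Lemma Rintegral_cvg_itv (f : R -> R) : mu.-integrable setT (EFin \o f) ->
  \int[mu]_(x in `[- n%:R, n%:R]) f x @[n --> \oo] --> \int[mu]_x f x.
Proof.
move=> intf; under eq_fun do rewrite Rintegral_mkcond.
have mf : measurable_fun [set: measurableTypeR R] f.
  by apply/measurable_EFinP; exact: measurable_int intf.
apply: (@Rintegral_dominated_cvg _ (measurableTypeR R) R mu
  (fun n => f \_ `[- n%:R, n%:R]) f (fun x => `|f x|)) => //.
- by move=> n; apply/(measurable_restrictT _ _).1 => //; exact: measurable_funTS.
- by have := integrable_abse intf.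
- apply: aeW => x; apply: cvg_near_cst; near=> n.
  rewrite patchE ifT// inE/= in_itv/= -ler_norml.
  by near: n; exact: nbhs_infty_ger.
- apply: aeW => x n; rewrite patchE; case: ifP => // _; by rewrite normr0.
Unshelve. all: end_near. Qed.

(* [y ^+ k * ramp_kernel m y] is a [polycos]; this primitive of it in [y] vanishes at
   infinity, so the k-th moment is zero without Fourier inversion. *)
Definition polycos_primitive p y theta : R :=
  \int[mu]_(s in `[1, 2]) (p.[s] / s * sin (s * y + theta)).

Lemma is_derive_horner_div p s : s != 0 ->
  is_derive s 1 (fun s => p.[s] / s) (p^`().[s] / s - p.[s] / s ^+ 2).
Proof.
move=> s0.
have h := @is_deriveM _ _ (horner p) (fun s => s^-1) s 1 _ _ (is_derive_poly p s)
  (is_deriveV (f := fun s => s) s0 (is_derive_id s 1)).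
by apply: trigger_derive h _; rewrite /GRing.scale/=; ring.
Qed.

Lemma continuous_horner_div p n s : s != 0 -> {for s, continuous (fun s => p.[s] / s ^+ n)}.
Proof.
move=> s0; apply: cvgM; first exact: continuous_horner.
by apply: cvgV; [rewrite expf_neq0|exact: exprn_continuous].
Qed.

(** One integration by parts in s: the zeros of p at 1 and 2 kill the boundary terms, and 1/s <= 1
    on [1,2] bounds what remains. *)
Lemma polycos_primitive_decay p theta : p.[1] = 0 -> p.[2] = 0 ->
  {M : R | forall y, `|y * polycos_primitive p y theta| <= M}.
Proof.
move=> p1 p2.
have [M1 h1] := @horner_bound R p; have [M2 h2] := @horner_bound R p^`().
exists ((M2 + M1) * (2 - 1)) => y.
have s0 s : 1 <= s <= 2 -> s != 0 by move=> /andP[s1 _]; rewrite gt_eqF//; lra.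
have cp n : {in `[1, 2], continuous (fun s => p.[s] / s ^+ n)}.
  by move=> s; rewrite in_itv/= => /s0; exact: continuous_horner_div.
have cp' n : {in `[1, 2], continuous (fun s => p^`().[s] / s ^+ n)}.
  by move=> s; rewrite in_itv/= => /s0; exact: continuous_horner_div.
have cf : {in `[1, 2], continuous (fun s => p^`().[s] / s - p.[s] / s ^+ 2)}.
  by move=> s s12; apply: cvgB; [exact: (cp' 1%N)|exact: cp].
have -> : y * polycos_primitive p y theta =
    \int[mu]_(s in `[1, 2])
      ((p^`().[s] / s - p.[s] / s ^+ 2) * cos (s * y + theta)).
  rewrite /polycos_primitive -RintegralZl//; last first.
    apply: in_continuous_integrable => s s12.
    by apply: cvgM; [exact: (cp 1%N)|exact: continuous_sin_affine].
  under eq_Rintegral do rewrite mulrCA.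
  have dp s : 1 <= s <= 2 ->
      is_derive s 1 (fun s => p.[s] / s) (p^`().[s] / s - p.[s] / s ^+ 2).
    by move=> /s0; exact: is_derive_horner_div.
  have dcos s : 1 <= s <= 2 ->
      is_derive s 1 (fun s => - cos (s * y + theta)) (y * sin (s * y + theta)).
    move=> _; have := is_derive_sin_affine y (theta - pi / 2) s.
    under eq_fun do rewrite addrA sinBpihalf.
    by rewrite addrA cosBpihalf mulrC.
  rewrite (Rintegral_by_parts _ dp dcos)//; last 2 first.
  - by lra.
  - move=> s _; apply: cvgM; [exact: cvg_cst|exact: continuous_sin_affine].
  rewrite p1 p2 !mul0r subrr sub0r -mulN1r -RintegralZl//; last first.
    apply: in_continuous_integrable => s s12.
    by apply: cvgM; [exact: cf|apply: cvgN; exact: continuous_cos_affine].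
  by apply: eq_Rintegral => s _; ring.
apply: le_normr_Rintegral_itv => [|s s12|s s12]; first by lra.
  by apply: cvgM; [exact: cf|exact: continuous_cos_affine].
rewrite normrM -[leRHS]mulr1 ler_pM ?cos_max//.
have /andP[s1 s2] := s12; have s02 : 0 <= s <= 2 by lra.
have s'1 : `|s^-1| <= 1 by rewrite ger0_norm ?invr_ge0 ?invf_le1//; lra.
rewrite (le_trans (ler_normB _ _))// lerD// normrM.
  by rewrite -[leRHS]mulr1 ler_pM// h2.
by rewrite -[leRHS]mulr1 ler_pM ?h1// -exprVn normrX exprn_ile1.
Qed.

(** Differentiation under the integral: the factor s of the chain rule cancels the division by s,
    which is harmless on [1,2]. *)
Lemma is_derive_polycos_primitive p theta y :
  is_derive y 1 (fun y => polycos_primitive p y theta) (polycos p y theta).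
Proof.
have [M hM] := @horner_bound R p.
have s0 s : 1 <= s <= 2 -> s != 0 by move=> /andP[s1 _]; rewrite gt_eqF//; lra.
pose f z s := p.[s] / s * sin (s * z + theta).
have df (z s : R) : is_derive z 1 (f ^~ s) (p.[s] / s * (cos (s * z + theta) * s)).
  have := is_derive_sin_affine s theta z.
  under eq_fun do rewrite mulrC; rewrite [z * s]mulrC => h.
  exact: is_deriveZ.
have Iy : `]y - 1, y + 1[%classic y by rewrite /= in_itv/=; lra.
have intf z : `]y - 1, y + 1[%classic z -> mu.-integrable `[1, 2] (EFin \o f z).
  move=> _; apply: in_continuous_integrable => s; rewrite in_itv/= => /s0 ?.
  apply: cvgM; last exact: continuous_sin_affine.
  exact: (@continuous_horner_div _ 1).
have derf z s : `]y - 1, y + 1[%classic z -> `[1, 2]%classic s -> derivable (f ^~ s) z 1.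
  by move=> _ _; have [] := df z s.
have d1E z s : `[1, 2]%classic s -> partial1of2 f z s = p.[s] * cos (s * z + theta).
  rewrite /= in_itv/= => /s0 ?; rewrite partial1of2E.
  by have [_ ->] := df z s; rewrite mulrCA divfK// mulrC.
have M0 : 0 <= M by rewrite (le_trans _ (hM 1 _))//; lra.
have intM : mu.-integrable `[1, 2] (EFin \o (cst M)).
  by apply: in_continuous_integrable => s _; exact: cvg_cst.
have ub z s : `]y - 1, y + 1[%classic z -> `[1, 2]%classic s ->
    `|partial1of2 f z s| <= cst M s.
  move=> _ s12; rewrite d1E// normrM -[leRHS]mulr1 ler_pM ?cos_max//.
  by rewrite hM//; move: s12; rewrite /= in_itv/=; lra.
have mI : measurable (`[1, 2] : set (measurableTypeR R)) by [].
apply: DeriveDef.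
  exact: (derivable_under_integral mI Iy intf derf (fun=> M0) intM ub).
rewrite -derive1E.
rewrite (differentiation_under_integral mI Iy intf derf (fun=> M0) intM ub)//.
by apply: eq_Rintegral => s; rewrite inE => /d1E ->.
Qed.

Lemma Rintegral_expr_ramp_kernel m k : (0 < k)%N -> (k.+2 <= m)%N ->
  \int[mu]_x (x ^+ k * ramp_kernel m x) = 0.
Proof.
move=> k0 km; have km' : (k < m)%N by exact: ltnW.
pose p : {poly R} := derivn k (ramp_poly m); pose theta : R := k%:R * (pi / 2).
have [M hM] := @polycos_primitive_decay p theta
  (derivn_ramp_poly1 (introT andP (conj k0 km'))) (derivn_ramp_poly2 km').
have dP y : is_derive y 1 (fun y => pi^-1 * polycos_primitive p y theta)
    (y ^+ k * ramp_kernel m y).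
  have km1 : (0 < k <= m)%N by rewrite k0 ltnW.
  rewrite (expr_ramp_kernel y km1).
  by apply: is_deriveZ; exact: is_derive_polycos_primitive.
have cV : continuous (fun y => y ^+ k * ramp_kernel m y).
  by move=> y; apply: cvgM; [exact: exprn_continuous|exact: continuous_ramp_kernel].
have := Rintegral_cvg_itv (integrable_expr_ramp_kernel km).
suff : \int[mu]_(x in `[- n%:R, n%:R]) (x ^+ k * ramp_kernel m x) @[n --> \oo] --> (0 : R).
  by move=> c0 c1; apply: (cvg_unique _ c1 c0).
(* Starting at n+1 keeps the interval nondegenerate for the fundamental theorem; each endpoint then
   contributes at most M / (pi (n+1)). *)
rewrite -cvg_shiftS/=.
apply: (@squeeze_cvgr _ _ _ _ (fun n => - (2 * (pi^-1 * M) * harmonic n))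
  (fun n => 2 * (pi^-1 * M) * harmonic n)).
- near=> n; rewrite -ler_norml.
  have n0 : 0 < n.+1%:R :> R by rewrite ltr0Sn.
  have ab : - n.+1%:R < n.+1%:R :> R by lra.
  rewrite (Rintegral_FTC ab (fun x _ => dP x)); last by move=> x _; exact: cV.
  rewrite -mulrBr normrM ger0_norm ?invr_ge0 ?pi_ge0// -mulrA mulrCA -mulrA.
  rewrite ler_wpM2l ?invr_ge0 ?pi_ge0// mulrCA mulrA.
  rewrite ler_pdivlMr// mulrC -[X in X * _](gtr0_norm n0) -normrM mulrBr.
  rewrite (le_trans (ler_normB _ _))// (_ : 2 * M = M + M) ?lerD//; last ring.
  by have := hM (- n.+1%:R); rewrite mulNr normrN.
- rewrite -[X in _ --> X]oppr0; apply: cvgN.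
  rewrite -[X in _ --> X](mulr0 (2 * (pi^-1 * M))).
  by apply: cvgM; [exact: cvg_cst|exact: cvg_harmonic].
- rewrite -[X in _ --> X](mulr0 (2 * (pi^-1 * M))).
  by apply: cvgM; [exact: cvg_cst|exact: cvg_harmonic].
Unshelve. all: end_near. Qed.

(** The decay gives integrable moments for the exponents k with k+2 <= m; contact order p+2 reaches
    k = p. *)
Lemma kernel_order_ramp (p : nat) : kernel_order (flat_top_kernel (@ramp R p.+2)) p.
Proof.
have reE k : (fun s => complex.Re ((s ^+ k)%:C * flat_top_kernel (ramp p.+2) s)) =
    (fun s => s ^+ k * ramp_kernel p.+2 s).
  by apply/funext => s; rewrite flat_top_kernel_ramp//= mulr0 subr0.
have imE k : (fun s => complex.Im ((s ^+ k)%:C * flat_top_kernel (ramp p.+2) s)) = cst 0.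
  by apply/funext => s; rewrite flat_top_kernel_ramp//= mulr0 mul0r addr0.
have ik k : (k <= p)%N ->
    cintegrable mu (fun s => (s ^+ k)%:C * flat_top_kernel (ramp p.+2) s).
  move=> kp; split; rewrite ?reE ?imE.
    by apply: integrable_expr_ramp_kernel; rewrite !ltnS.
  exact: integrable0.
split; first exact: ik.
move=> k /andP[k0 kp]; split; first exact/ik/ltnW.
by rewrite /cintegral reE imE Rintegral_expr_ramp_kernel// ?Rintegral_cst ?mul0r// !ltnS ltnW.
Qed.

End RampMoments.

(** * Summability of the window series *)

Lemma sum_le_esum (R : realType) (T : choiceType) (a : T -> \bar R) (s : seq T) :
  uniq s -> (\sum_(i <- s) a i <= \esum_(i in [set: T]) a i)%E.
Proof.
move=> us; apply: esum_ge; exists [set` s].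
  by split => //; exact: finite_seq.
by rewrite fsbig_seq.
Qed.

Lemma esum_le_sum (R : realType) (T : choiceType) (a : T -> \bar R) (M : \bar R) :
  (forall s : seq T, uniq s -> (\sum_(i <- s) a i <= M)%E) ->
  (\esum_(i in [set: T]) a i <= M)%E.
Proof.
move=> h; apply: ge_ereal_sup => _ [A [finA _] <-].
by rewrite fsbig_finite//= h.
Qed.

Definition symseq (n : nat) : seq int := [seq k%:Z - n%:Z | k <- iota 0 n.*2.+1].

Lemma uniq_symseq n : uniq (symseq n).
Proof. by rewrite map_inj_uniq ?iota_uniq// => i j; lia. Qed.

Lemma mem_symseq n (m : int) : (`|m| <= n)%N -> m \in symseq n.
Proof.
move=> mn; apply/mapP; exists (absz (m + n%:Z)); last by lia.
by rewrite mem_iota; lia.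
Qed.

Lemma big_symseq (V : zmodType) (a : int -> V) n :
  \sum_(m <- symseq n) a m = symsum a n.
Proof.
by rewrite big_map -[iota _ _]/(index_iota 0 n.*2.+1) big_mkord.
Qed.

(** A finite set of integers lies in some symmetric window, and the added terms are nonnegative. *)
Lemma sum_le_symsum (R : realDomainType) (a : int -> R) (s : seq int) :
  (forall m, 0 <= a m) -> uniq s -> exists n, \sum_(m <- s) a m <= symsum a n.
Proof.
move=> a0 us; exists (\max_(m <- s) `|m|)%N; rewrite -big_symseq.
set n := (\max_(m <- s) _)%N.
have sn : {subset s <= symseq n}.
  by move=> m ms; apply: mem_symseq; exact: leq_bigmax_seq.
rewrite [leRHS](bigID (mem s))/= -[leLHS]addr0 lerD ?sumr_ge0//.
rewrite -[leRHS]big_filter le_eqVlt; apply/orP; left; apply/eqP/perm_big.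
apply: uniq_perm => //; first by rewrite filter_uniq// uniq_symseq.
move=> m; rewrite mem_filter andb_idr//; exact: sn.
Qed.

Lemma esum_int_le (R : realType) (a : int -> R) (M : R) :
  (forall m, 0 <= a m) -> (forall n, symsum a n <= M) ->
  (\esum_(m in [set: int]) (a m)%:E <= M%:E)%E.
Proof.
move=> a0 aM; apply: esum_le_sum => s us.
have [n sn] := sum_le_symsum a0 us.
by rewrite sumEFin lee_fin (le_trans sn).
Qed.

Lemma symsum_oneDsqrV (R : realType) n :
  symsum (fun m : int => (1 + m%:~R ^+ 2)^-1 : R) n <= 9.
Proof.
(* Telescoping majorant: 9 - 8/(n+1) equals 1 at n = 0, and its increment 8/((n+1)(n+2)) dominates
   the two new terms 2/(1 + (n+1)^2). *)
suff : symsum (fun m : int => (1 + m%:~R ^+ 2)^-1 : R) n <= 9 - 8 / n.+1%:R.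
  by move=> /le_trans; apply; rewrite gerBl divr_ge0.
elim: n => [|n IH]; first by rewrite symsum0 expr0n addr0 invr1; lra.
rewrite symsumS mulrNz sqrrN (le_trans (lerD IH (lexx _)))//.
rewrite -pmulrn.
have n0 : 0 <= n%:R :> R by [].
rewrite -[n.+2%:R]natr1 -[n.+1%:R]natr1.
have h1 : n%:R + 1 != 0 :> R by rewrite gt_eqF// ltr_wpDl.
have h2 : n%:R + 1 + 1 != 0 :> R by rewrite gt_eqF// -addrA ltr_wpDl.
have h3 : 0 < 1 + (n%:R + 1) ^+ 2 :> R by rewrite ltr_pwDl// sqr_ge0.
have -> : 9 - 8 / (n%:R + 1 + 1) = 9 - 8 / (n%:R + 1) + 8 / ((n%:R + 1) * (n%:R + 1 + 1)) :> R.
  by field; rewrite h1 h2.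
rewrite lerD2l -mulr2n -[leLHS]mulr_natl ler_pdivrMr//.
rewrite mulrAC ler_pdivlMr ?mulr_gt0 ?ltr_wpDl//.
nra.
Qed.

(** * Admissibility of the ramp *)

Section RampAdmissible.
Context {R : realType}.
Local Open Scope complex_scope.
Local Notation mu := (@lebesgue_measure R).

Lemma normc_real (x : R) : ComplexField.Normc.normc (x%:C) = `|x|.
Proof. by rewrite /= expr0n addr0 sqrtr_sqr. Qed.

Lemma supported_continuous_integrable (f : R -> R) (a b : R) : continuous f ->
  (forall x, x \notin `[a, b] -> f x = 0) -> mu.-integrable setT (EFin \o f).
Proof.
move=> cf f0; have := continuous_itv_integrable a b cf.
rewrite integrable_mkcond//; congr (mu.-integrable _ _).
apply/funext => x; rewrite patchE; case: ifPn => //.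
by rewrite notin_setE /= => /negP/f0 ->.
Qed.

Lemma flat_top_ramp m : (0 < m)%N -> flat_top (@ramp R m).
Proof.
move=> m0; exists 1, (ramp m); split.
- by split => //; rewrite ramp_eq1// normr1.
- by move=> s; have /andP[r0 r1] := ramp_itv m s; rewrite r1 andbT (le_trans _ r0).
- exact: rampN.
- split; first by exists set0 => // s _; exact: continuous_ramp.
  have /integrableP[_] : mu.-integrable setT (EFin \o (fun s => ramp m s ^+ 2)).
    apply: (@supported_continuous_integrable _ (-2) 2) => x.
      by apply: cvgM; exact: continuous_ramp.
    by rewrite expr2; exact: ramp_supported.
  apply: le_lt_trans; apply: ge0_le_integral => //=.
  + by move=> x _; rewrite lee_fin sqr_ge0.
  + apply/measurable_EFinP; apply: continuous_measurable_fun => x.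
    by apply: cvgM; exact: continuous_ramp.
  + apply/measurable_EFinP; apply: continuous_measurable_fun => x.
    apply: (continuous_comp (f := fun s => ramp m s ^+ 2)); last exact: norm_continuous.
    by apply: cvgM; exact: continuous_ramp.
  + by move=> x _; rewrite lee_fin ler_norm.
- by move=> s; case: ifPn => // s1; rewrite ramp_eq1.
Qed.

Definition periodized_kernel m (b x : R) (j : int) : R :=
  b^-1 * ramp_kernel m ((x + 2 * pi * j%:~R) / b).

Lemma window_term_ramp m b x j : (0 < m)%N ->
  window_term (flat_top_kernel (ramp m)) b x j = (periodized_kernel m b x j)%:C.
Proof. by move=> m0; rewrite /window_term flat_top_kernel_ramp// -rmorphM. Qed.

Lemma periodized_kernel_decay m b x : (2 <= m)%N -> 0 < b ->
  {M : R | 0 <= M & forall j, `|periodized_kernel m b x j| <= M * (1 + j%:~R ^+ 2)^-1}.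
Proof.
move=> m2 b0; have [M M0 hM] := @ramp_kernel_decay R m 0 m2.
have b0' := ltW b0.
(* If y is the rescaled argument, 2 pi j = b y - x, so j^2 <= 2 b^2 y^2 + 2 x^2 and 1 + j^2 <= (1 +
   2 b^2 + 2 x^2)(1 + y^2). *)
exists (b^-1 * M * (1 + 2 * b ^+ 2 + 2 * x ^+ 2)) => [|j].
  apply: mulr_ge0; first by rewrite mulr_ge0 ?invr_ge0.
  by have := sqr_ge0 b; have := sqr_ge0 x; lra.
rewrite /periodized_kernel normrM ger0_norm ?invr_ge0//.
rewrite -[X in _ <= X]mulrA -[X in _ <= X]mulrA ler_wpM2l ?invr_ge0//.
have := hM ((x + 2 * pi * j%:~R) / b); rewrite expr0 mul1r => /le_trans; apply.
rewrite ler_wpM2l//; set y := _ / b.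
have yE : 2 * pi * j%:~R = b * y - x.
  by rewrite mulrCA mulfV ?gt_eqF// mulr1 addrAC subrr add0r.
have j2 : (j%:~R : R) ^+ 2 <= (b * y - x) ^+ 2.
  rewrite -yE [leRHS]exprMn ler_peMl ?sqr_ge0//.
  by rewrite exprn_ege1//; have := pi_ge2 R; lra.
have h : (b * y - x) ^+ 2 <= 2 * (b * y) ^+ 2 + 2 * x ^+ 2.
  by have := sqr_ge0 (b * y + x); lra.
have j1 : 0 < 1 + (j%:~R : R) ^+ 2 by rewrite ltr_pwDl ?sqr_ge0.
have y1 : 0 < 1 + y ^+ 2 by rewrite ltr_pwDl ?sqr_ge0.
rewrite -[leLHS]mul1r ler_pdivrMr// mulrAC ler_pdivlMr// mul1r.
rewrite (le_trans (lerD (lexx 1) (le_trans j2 h)))// exprMn.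
have := mulr_ge0 (sqr_ge0 x) (sqr_ge0 y); have := sqr_ge0 b; have := sqr_ge0 y; lra.
Qed.

Lemma czsummable_window_ramp m b x : (2 <= m)%N -> 0 < b ->
  czsummable (window_term (flat_top_kernel (@ramp R m)) b x).
Proof.
move=> m2 b0; have m0 : (0 < m)%N by apply: leq_trans m2.
have [M M0 hM] := periodized_kernel_decay x m2 b0.
rewrite /czsummable; under eq_esum do rewrite window_term_ramp// normc_real.
apply: (@le_lt_trans _ _ (M * 9)%:E); last exact: ltry.
apply: esum_int_le => // n.
apply: le_trans (ler_symsum (fun j _ => hM j)) _.
by rewrite symsumZ ler_wpM2l// symsum_oneDsqrV.
Qed.

Lemma admissible_ramp m : (2 <= m)%N -> admissible_flat_top (@ramp R m).
Proof.
move=> m2; have m0 : (0 < m)%N by apply: leq_trans m2.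
split; first exact: flat_top_ramp.
- apply: (@supported_continuous_integrable _ (-2) 2); first exact: continuous_ramp.
  by move=> x x2; rewrite -[LHS]mulr1 (@ramp_supported _ m (cst 1)).
- by move=> b x b0; exact: czsummable_window_ramp.
Qed.

End RampAdmissible.

Lemma is_cvg_symsum (R : realType) (a : int -> R) (M : R) :
  (forall n, symsum (fun j => `|a j|) n <= M) -> cvgn (symsum a).
Proof.
(* Grouping k with -k turns the symmetric sums into the partial sums of an ordinary series, with the
   index shifted by one. *)
move=> aM; pose u (k : nat) := if k is k'.+1 then a k%:Z + a (- k%:Z) else a 0.
have symE (b : int -> R) (v : nat -> R) : v 0%N = b 0 ->
    (forall k, v k.+1 = b k.+1%:Z + b (- k.+1%:Z)) ->
    forall n, series v n.+1 = symsum b n.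
  move=> v0 vS; elim=> [|n IH].
    by rewrite symsum0 /series/= big_nat1.
  by rewrite symsumS -vS -IH /series/= [LHS]big_nat_recr.
have cu : cvgn (series u).
  apply: normed_cvg.
  pose v (k : nat) := if k is k'.+1 then `|a k%:Z| + `|a (- k%:Z)| else `|a 0|.
  apply: (@nondecreasing_is_cvgn R).
    by apply: nondecreasing_series => k _ _; exact: normr_ge0.
  exists M => _ [n _ <-].
  have v0 k : 0 <= v k by case: k => [|k] //=; rewrite addr_ge0.
  apply: (@le_trans _ _ (series v n.+1)); last first.
    by rewrite (symE (fun j => `|a j|)).
  apply: (@le_trans _ _ (series v n)).
    apply: ler_sum => i _; case: i => [|i] //=; exact: ler_normD.
  by apply: nondecreasing_series.
have : series u n.+1 @[n --> \oo] --> limn (series u) by rewrite cvg_shiftS.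
by under eq_fun do rewrite (symE a u)//; move=> /cvgP.
Qed.

Lemma cvg_sumr (R : realType) (I : Type) (r : seq I) (f : I -> nat -> R) (l : I -> R) :
  (forall i, f i n @[n --> \oo] --> l i) ->
  \sum_(i <- r) f i n @[n --> \oo] --> \sum_(i <- r) l i.
Proof.
move=> fl; elim: r => [|i r IH].
  by under eq_fun do rewrite big_nil; rewrite big_nil; exact: cvg_cst.
by under eq_fun do rewrite big_cons; rewrite big_cons; exact: cvgD.
Qed.

(** * Poisson summation *)

Section Fejer.
Context {R : realType}.
Implicit Types (x t s b theta : R).
Local Notation mu := (@lebesgue_measure R).

(** n times the usual Fejer kernel, as a sum of Dirichlet kernels. *)
Definition fejer (n : nat) theta : R :=
  \sum_(i < n) symsum (fun j : int => cos (j%:~R * theta)) i.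

(** By the hook summation this is the sum of cos((t - u) theta) over t, u < n, that is, the squared
    modulus of the sum of the e^(i t theta). *)
Lemma fejer_ge0 n theta : 0 <= fejer n theta.
Proof.
rewrite /fejer -(sum_sum_symsum (fun j : int => cos (j%:~R * theta))).
suff -> : \sum_(t < n) \sum_(u < n) cos ((t%:Z - u%:Z)%:~R * theta) =
    (\sum_(t < n) cos (t%:R * theta)) ^+ 2 + (\sum_(t < n) sin (t%:R * theta)) ^+ 2.
  by rewrite addr_ge0 ?sqr_ge0.
rewrite !expr2 !big_distrlr -big_split/=; apply: eq_bigr => t _.
rewrite -big_split; apply: eq_bigr => u _ /=.
by rewrite intrB mulrBl cosB.
Qed.

(** Closed form of the Dirichlet kernel, multiplied out so that it also holds where sin(theta/2) =
    0. *)
Lemma symsum_cos_sin i theta :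
  symsum (fun j : int => cos (j%:~R * theta)) i * sin (theta / 2) =
  sin (i%:R * theta + theta / 2).
Proof.
elim: i => [|i IH]; first by rewrite symsum0 !mul0r cos0 mul1r add0r.
rewrite symsumS mulrDl IH mulrNz mulNr cosN -pmulrn.
have -> : i%:R * theta + theta / 2 = i.+1%:R * theta - theta / 2.
  by rewrite -[i.+1%:R]natr1; field.
by rewrite sinB sinD; ring.
Qed.

Lemma fejer_sin2 n theta :
  fejer n theta * sin (theta / 2) ^+ 2 = sin (n%:R * (theta / 2)) ^+ 2.
Proof.
rewrite /fejer; elim: n => [|n IH]; first by rewrite big_ord0 !mul0r sin0 expr0n.
rewrite big_ord_recr/= mulrDl IH.
rewrite (_ : symsum _ n * _ = sin (n%:R * theta + theta / 2) * sin (theta / 2)); last first.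
  by rewrite -symsum_cos_sin; ring.
set h := theta / 2.
have -> : n%:R * theta + h = n.+1%:R * h + n%:R * h by rewrite /h -[n.+1%:R]natr1; field.
have -> : sin h = sin (n.+1%:R * h - n%:R * h) by congr sin; rewrite -[n.+1%:R]natr1; ring.
(* sin(A + B) sin(A - B) = sin^2 A - sin^2 B, so each new term replaces sin^2 B by sin^2 A. *)
rewrite sinD sinB; set A := n.+1%:R * h; set B := n%:R * h.
transitivity (sin B ^+ 2 + (sin A ^+ 2 * (1 - sin B ^+ 2) - (1 - sin A ^+ 2) * sin B ^+ 2)).
  by rewrite -(cos2sin2 A) -(cos2sin2 B); ring.
by ring.
Qed.

Lemma normr_sin_le x : `|sin x| <= `|x|.
Proof.
have := cos_lipschitz (x - pi / 2) (- (pi / 2)).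
by rewrite cosBpihalf cosN cos_pihalf subr0 opprK subrK.
Qed.

Lemma cos_ge_quadratic x : 1 - x ^+ 2 / 2 <= cos x.
Proof.
have := cosD (x / 2) (x / 2); rewrite -splitr -!expr2 cos2sin2 => ->.
have := normr_sin_le (x / 2); rewrite -ler_sqr ?nnegrE// !real_normK ?num_real//.
rewrite exprMn exprVn; lra.
Qed.

(** A crude form of Jordan's inequality. On [0,1] the mean value theorem gives sin t >= t/2, since
    cos >= 1/2 there; beyond 1, sin x >= sin 1 >= 1/2 >= x/4 because x <= pi/2 < 2. *)
Lemma sin_ge_quarter x : 0 <= x <= pi / 2 -> x / 4 <= sin x.
Proof.
move=> /andP[x0 xpi].
have small t : 0 <= t <= 1 -> t / 2 <= sin t.
  move=> /andP[t0 t1].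
  have dsin z : z \in `]0, t[ -> is_derive z 1 (@sin R) (cos z).
    by move=> _; exact: is_derive_sin.
  have csin : {within `[0, t], continuous (@sin R)}.
    exact/continuous_subspaceT/continuous_sin.
  have [c] := MVT_segment t0 dsin csin.
  rewrite in_itv/= => /andP[c0 ct]; rewrite sin0 !subr0 => ->.
  rewrite mulrC ler_wpM2r// (le_trans _ (cos_ge_quadratic c))//.
  have : c ^+ 2 <= 1 by rewrite exprn_ile1// (le_trans ct).
  by lra.
have [x1|x1] := leP x 1; first by rewrite (le_trans _ (small x _)) ?x0//; lra.
have h1 : 1 / 2 <= sin 1 :> R by apply: small; lra.
have h2 := @pihalf_lt2 R.
have h3 : sin 1 <= sin x.
  rewrite ltW// ltr_sin ?in_itv//=; lra.
lra.
Qed.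

Lemma ler_sqr_sin_pi (u : R) : `|u| <= 2^-1 -> u ^+ 2 <= 4 * sin (pi * u) ^+ 2.
Proof.
move=> u2; have h : `|u| / 2 <= `|sin (pi * u)|.
  rewrite -[X in _ <= X](_ : `|sin `|pi * u| | = _); last first.
    by case: (ger0P (pi * u)) => // _; rewrite sinN normrN.
  apply: le_trans (ler_norm _); apply: le_trans (sin_ge_quarter _).
    rewrite normrM ger0_norm ?pi_ge0//.
    by have := ler_wpM2r (normr_ge0 u) (@pi_ge2 R); lra.
  rewrite normr_ge0 normrM ger0_norm ?pi_ge0//.
  by rewrite ler_wpM2l ?pi_ge0.
rewrite -[u ^+ 2]real_normK ?num_real// -[X in _ * X]real_normK ?num_real//.
have := ler_pM _ _ h h; rewrite !divr_ge0//= => /(_ isT isT); lra.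
Qed.

Lemma continuous_symsum_cos b i :
  continuous (fun s : R => symsum (fun j : int => cos (j%:~R * (s * b))) i).
Proof.
apply: continuous_sumr => k.
have := @continuous_cos_affine R (b * (k%:Z - i%:Z)%:~R) 0.
by under eq_fun do rewrite addr0 mulrA mulrC.
Qed.

Lemma continuous_fejer b n : continuous (fun s => fejer n (s * b)).
Proof. by apply: continuous_sumr => i; exact: continuous_symsum_cos. Qed.

Lemma sinD2pi_int (y : R) (j : int) : sin (y + j%:~R * (pi *+ 2)) = sin y.
Proof.
have sinDn (n : nat) (z : R) : sin (z + n%:R * (pi *+ 2)) = sin z.
  by rewrite mulr_natl; exact: periodicn (@sinD2pi R) n z.
case: j => n; first by rewrite -pmulrn sinDn.
by rewrite NegzE mulrNz mulNr -[LHS](sinDn n.+1) pmulrn subrK.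
Qed.

(** An interval of length b holds |j| full periods, so the primitive takes the same value at both
    ends. *)
Lemma Rintegral_cos_period b (c : R) (j : int) : 0 < b -> j != 0 ->
  \int[mu]_(s in `[c, c + b]) cos (j%:~R * (s * (2 * pi / b))) = 0.
Proof.
move=> b0 j0; pose w := j%:~R * (2 * pi / b).
have w0 : w != 0.
  by rewrite mulf_neq0 ?intr_eq0// gt_eqF// divr_gt0// mulr_gt0// pi_gt0.
have dF s : c <= s <= c + b -> is_derive s 1 (fun s => w^-1 * sin (s * w))
    (w^-1 * (cos (s * w) * w)).
  move=> _; apply: is_deriveZ; have := is_derive_sin_affine w 0 s.
  by under eq_fun do rewrite addr0; rewrite addr0.
have cc : continuous (fun s => cos (s * w)).
  by have := @continuous_cos_affine R w 0; under eq_fun do rewrite addr0.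
transitivity (\int[mu]_(s in `[c, c + b]) (w^-1 * (cos (s * w) * w))).
  apply: eq_Rintegral => s _; rewrite [RHS]mulrCA mulVf// mulr1; congr cos.
  by rewrite /w mulrCA.
rewrite (Rintegral_FTC _ dF) ?ltrDl//; last first.
  by move=> s _; apply: cvgM; [exact: cvg_cst|apply: cvgM; [exact: cc|exact: cvg_cst]].
rewrite -mulrBr mulrDl.
have -> : b * w = j%:~R * (pi *+ 2).
  by rewrite /w mulrCA; congr (_ * _); rewrite mulrC divfK ?gt_eqF// mulr_natl.
by rewrite sinD2pi_int subrr mulr0.
Qed.

Lemma Rintegral_fejer_period b c n : 0 < b ->
  \int[mu]_(s in `[c, c + b]) fejer n (s * (2 * pi / b)) = n%:R * b.
Proof.
move=> b0; rewrite /fejer Rintegral_sum_continuous; last by move=> i; exact: continuous_symsum_cos.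
transitivity (\sum_(i < n) b); last by rewrite sumr_const card_ord mulr_natl.
apply: eq_bigr => i _.
rewrite /symsum Rintegral_sum_continuous; last first.
  move=> k; have := @continuous_cos_affine R (2 * pi / b * (k%:Z - i%:Z)%:~R) 0.
  by under eq_fun do rewrite addr0 mulrA mulrC.
have -> : \sum_(k < i.*2.+1)
    \int[mu]_(s in `[c, c + b]) cos ((k%:Z - i%:Z)%:~R * (s * (2 * pi / b))) =
    symsum (fun j : int => if j == 0 then b else 0) i.
  apply: eq_bigr => k _; case: eqP => [->|/eqP j0]; last exact: Rintegral_cos_period.
  under eq_Rintegral do rewrite mul0r cos0.
  rewrite Rintegral_cst//= lebesgue_measure_itv/= lte_fin ltrDl b0.
  by rewrite -EFinD/= addrAC subrr add0r mul1r.
rewrite (@symsum_finite _ _ 0 i) ?symsum0 ?eqxx// => m m0.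
by case: eqP m0 => // ->.
Qed.

(* AM-GM splits [L |s - k b|] into [e] and a multiple of [(s - k b)^2], whose product
   with the kernel stays bounded while the mass of the kernel grows like [n]. *)
Lemma fejer_concentrate b (k : R) n (phi : R -> R) (L e : R) : 0 < b -> 0 < e ->
  (exists j : int, k = j%:~R) ->
  (forall s t, `|phi s - phi t| <= L * `|s - t|) ->
  `|\int[mu]_(s in `[b * k - b / 2, b * k - b / 2 + b])
      (phi s * fejer n (s * (2 * pi / b))) - n%:R * (b * phi (b * k))|
  <= e * (n%:R * b) + L ^+ 2 * (4 * b ^+ 2) / e * b.
Proof.
move=> b0 e0 [j kj] phiL; set w := 2 * pi / b; set a := b * k - b / 2.
have cphi : continuous phi by exact: continuous_lipschitz phiL.
have cF : continuous (fun s => fejer n (s * w)) := @continuous_fejer w n.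
have -> : n%:R * (b * phi (b * k)) =
    \int[mu]_(s in `[a, a + b]) (phi (b * k) * fejer n (s * w)).
  by rewrite RintegralZl ?Rintegral_fejer_period//; [ring|exact: continuous_itv_integrable].
have cpF : continuous (fun s => phi s * fejer n (s * w)).
  by move=> s; apply: cvgM; [exact: cphi|exact: cF].
have ckF : continuous (fun s => phi (b * k) * fejer n (s * w)).
  by move=> s; apply: cvgM; [exact: cvg_cst|exact: cF].
rewrite -RintegralB//; [|exact: continuous_itv_integrable..].
have cB : continuous (fun s => phi s * fejer n (s * w) - phi (b * k) * fejer n (s * w)).
  by move=> s; apply: cvgB; [exact: cpF|exact: ckF].
apply: le_trans (le_normr_Rintegral _ _) _ => //.
  exact: continuous_itv_integrable.
have ceF : continuous (fun s => e * fejer n (s * w) + L ^+ 2 * (4 * b ^+ 2) / e).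
  by move=> s; apply: cvgD; [apply: cvgM; [exact: cvg_cst|exact: cF]|exact: cvg_cst].
have -> : e * (n%:R * b) + L ^+ 2 * (4 * b ^+ 2) / e * b =
    \int[mu]_(s in `[a, a + b]) (e * fejer n (s * w) + L ^+ 2 * (4 * b ^+ 2) / e).
  have ceF1 : continuous (fun s => e * fejer n (s * w)).
    by move=> s; apply: cvgM; [exact: cvg_cst|exact: cF].
  rewrite RintegralD//; last 2 first.
  - exact: continuous_itv_integrable.
  - by apply: continuous_itv_integrable => s; exact: cvg_cst.
  rewrite RintegralZl ?Rintegral_fejer_period//; last exact: continuous_itv_integrable.
  rewrite Rintegral_cst//= lebesgue_measure_itv/= lte_fin ltrDl b0.
  by rewrite -EFinD/= [a + b]addrC addrK.
apply: le_Rintegral => //.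
- apply: continuous_itv_integrable => s.
  by apply: cvg_norm; exact: cB.
- exact: continuous_itv_integrable.
move=> s; rewrite /= in_itv/= => /andP[sa sb].
have F0 := fejer_ge0 n (s * w).
rewrite -mulrBl normrM [X in _ * X]ger0_norm//.
set d := s - b * k.
(* d is at most half a period, so for u = d/b the angle s w / 2 equals pi u modulo pi. Then u^2 <= 4
   sin^2(pi u), and the kernel times this squared sine is at most 1. *)
have dF : d ^+ 2 * fejer n (s * w) <= 4 * b ^+ 2.
  pose u := d / b.
  have u2 : `|u| <= 2^-1.
    rewrite /u normrM normfV (gtr0_norm b0) ler_pdivrMr// /d ler_norml.
    by rewrite /a in sa sb; lra.
  have swE : s * w / 2 = pi * u + j%:~R * pi.
    by rewrite /w /u /d kj; field; rewrite gt_eqF.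
  have sinE2 : sin (s * w / 2) ^+ 2 = sin (pi * u) ^+ 2.
    rewrite swE; have sinDn (m : nat) (z : R) : sin (z + m%:R * pi) ^+ 2 = sin z ^+ 2.
      elim: m z => [|m IH] z; first by rewrite mul0r addr0.
      by rewrite -natr1 mulrDl mul1r addrA sinDpi sqrrN IH.
    case: (j) => m; first by rewrite -pmulrn sinDn.
    by rewrite NegzE mulrNz mulNr -[LHS](sinDn m.+1) pmulrn subrK.
  have -> : d ^+ 2 = b ^+ 2 * u ^+ 2 by rewrite -exprMn /u mulrC divfK ?gt_eqF.
  rewrite -mulrA [leRHS]mulrC ler_wpM2l ?sqr_ge0//.
  apply: le_trans (ler_wpM2r F0 (ler_sqr_sin_pi u2)) _.
  rewrite -mulrA -sinE2 [sin _ ^+ 2 * _]mulrC fejer_sin2 -[leRHS]mulr1 ler_wpM2l//.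
have h : `|phi s - phi (b * k)| <= e + L ^+ 2 * d ^+ 2 / e.
  apply: le_trans (phiL _ _) _; rewrite -/d.
  have := sqr_ge0 (L * `|d| - e).
  rewrite -[d ^+ 2]real_normK ?num_real// => h.
  rewrite -(ler_pM2r e0) mulrDl divfK ?gt_eqF//.
  have := mulr_ge0 (sqr_ge0 L) (sqr_ge0 `|d|); nra.
apply: le_trans (ler_wpM2r F0 h) _.
rewrite mulrDl lerD2l mulrAC ler_wpM2r ?invr_ge0 ?(ltW e0)// -mulrA.
by rewrite ler_wpM2l ?sqr_ge0.
Qed.

Lemma fejer_cvg b (k : R) (phi : R -> R) (L : R) : 0 < b ->
  (exists j : int, k = j%:~R) ->
  (forall s t, `|phi s - phi t| <= L * `|s - t|) ->
  n.+1%:R^-1 * \int[mu]_(s in `[b * k - b / 2, b * k - b / 2 + b])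
      (phi s * fejer n.+1 (s * (2 * pi / b))) @[n --> \oo] --> b * phi (b * k).
Proof.
move=> b0 kj phiL; apply/cvgrPdist_le => e e0.
(* This makes the growing part of the error exactly half of the allowed (n+1) e; the other part, C,
   is independent of n and eventually fits in the other half. *)
pose e' := e / (2 * b).
have e'0 : 0 < e' by rewrite divr_gt0// mulr_gt0.
pose C := L ^+ 2 * (4 * b ^+ 2) / e' * b.
near=> n.
have n0 : 0 < n.+1%:R :> R by rewrite ltr0Sn.
rewrite -(ler_pM2l n0) -[X in X * `|_|](gtr0_norm n0) -normrM mulrBr.
rewrite mulVKf ?gt_eqF// distrC.
apply: le_trans (fejer_concentrate n.+1 b0 e'0 kj phiL) _.
rewrite -/C.
have -> : e' * (n.+1%:R * b) = n.+1%:R * (e / 2).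
  by rewrite /e'; field; rewrite gt_eqF.
rewrite [e in leRHS]splitr [leRHS]mulrDr lerD2l.
rewrite -ler_pdivrMr ?divr_gt0//.
have : C / (e / 2) <= n%:R by near: n; exact: nbhs_infty_ger.
by move=> /le_trans; apply; rewrite ler_nat.
Unshelve. all: end_near. Qed.

End Fejer.

Section Poisson.
Context {R : realType}.
Local Open Scope complex_scope.
Implicit Types (x t s b theta : R).
Local Notation mu := (@lebesgue_measure R).

Lemma ramp_cos_lipschitz m (y s t : R) :
  `|ramp m s * cos (s * y) - ramp m t * cos (t * y)| <=
  ((m * m)%:R + `|y|) * `|s - t|.
Proof.
have -> : ramp m s * cos (s * y) - ramp m t * cos (t * y) =
  (ramp m s - ramp m t) * cos (s * y) + ramp m t * (cos (s * y) - cos (t * y)) by ring.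
rewrite (le_trans (ler_normD _ _))// [leRHS]mulrDl lerD//.
  rewrite normrM -[leRHS]mulr1 ler_pM// ?cos_max//; exact: ramp_lipschitz.
have /andP[r0 r1] := ramp_itv m t.
rewrite normrM ger0_norm// -[leRHS]mul1r ler_pM// (le_trans (cos_lipschitz _ _))//.
by rewrite -mulrBl normrM mulrC.
Qed.

(** The shift of x by 2 pi j expands into a cosine and a sine in j; the sine sum is odd in j and
    cancels over the symmetric range, which leaves a Dirichlet kernel under the integral. *)
Lemma symsum_periodized_kernel m b x i : 0 < b ->
  symsum (periodized_kernel m b x) i = (2 * pi * b)^-1 *
    \int[mu]_(s in `[-2, 2]) (ramp m s * cos (s * (x / b)) *
      symsum (fun j : int => cos (j%:~R * (s * (2 * pi / b)))) i).
Proof.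
move=> b0; pose w := 2 * pi / b.
have cc y : continuous (fun s => ramp m s * cos (s * y)) := @continuous_ramp_cos0 R m y.
transitivity (symsum (fun j => (2 * pi * b)^-1 *
   \int[mu]_(s in `[-2, 2]) (ramp m s * cos (s * (x / b + j%:~R * w)))) i).
  apply: eq_symsum => j _; rewrite /periodized_kernel /ramp_kernel.
  rewrite mulrA; congr (_ * _); first by rewrite [RHS]invfM mulrC.
  by apply: eq_Rintegral => s _; congr (_ * cos (_ * _)); rewrite /w; ring.
rewrite symsumZ; congr (_ * _).
rewrite /symsum -Rintegral_sum_continuous; last by move=> k; exact: cc.
apply: eq_Rintegral => s _; rewrite -!mulr_sumr -mulrA; congr (_ * _).
rewrite -[LHS]/(symsum (fun j : int => cos (s * (x / b + j%:~R * w))) i).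
rewrite -[X in _ = _ * X]/(symsum (fun j : int => cos (j%:~R * (s * w))) i).
set g := symsum (fun j : int => cos (j%:~R * (s * w))) i.
pose h := symsum (fun j : int => sin (j%:~R * (s * w))) i.
have h0 : h = 0.
  have : h = - h.
    rewrite /h -[LHS]symsumN -mulN1r -symsumZ; apply: eq_symsum => j _.
    by rewrite mulrNz mulNr sinN mulN1r.
  lra.
transitivity (cos (s * (x / b)) * g - sin (s * (x / b)) * h).
  rewrite /g /h -!symsumZ -symsumB; apply: eq_symsum => j _.
  by rewrite mulrDr cosD; congr (_ * cos _ - _ * sin _); exact: mulrCA.
by rewrite h0 mulr0 subr0.
Qed.

Lemma mean_periodized_kernel m b x n : 0 < b ->
  arithmetic_mean (symsum (periodized_kernel m b x)) n = (2 * pi * b)^-1 *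
    (n.+1%:R^-1 * \int[mu]_(s in `[-2, 2]) (ramp m s * cos (s * (x / b)) *
      fejer n.+1 (s * (2 * pi / b)))).
Proof.
move=> b0; rewrite /arithmetic_mean /series/= big_mkord mulrCA; congr (_ * _).
under eq_bigr do rewrite symsum_periodized_kernel//.
rewrite -mulr_sumr -Rintegral_sum_continuous; last first.
  move=> i s; apply: cvgM; first exact: continuous_ramp_cos0.
  exact: continuous_symsum_cos.
by congr (_ * _); apply: eq_Rintegral => s _; rewrite -mulr_sumr.
Qed.

(* The kernel series converges absolutely, so it equals its Cesaro limit; the Cesaro
   means are Fejer integrals of [ramp m], which concentrate at the points [b * k]. *)
Lemma poisson_ramp m b x (K : nat) : (2 <= m)%N -> 0 < b -> 2 <= b * K%:R ->
  zsum (periodized_kernel m b x) =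
  (2 * pi)^-1 * symsum (fun k : int => ramp m (b * k%:~R) * cos (k%:~R * x)) K.
Proof.
move=> m2 b0 bK; have m0 : (0 < m)%N by apply: leq_trans m2.
have [M M0 hM] := periodized_kernel_decay x m2 b0.
have : cvgn (symsum (periodized_kernel m b x)).
  apply: (@is_cvg_symsum _ _ (M * 9)) => n.
  apply: le_trans (ler_symsum (fun j _ => hM j)) _.
  by rewrite symsumZ ler_wpM2l// symsum_oneDsqrV.
move=> /cesaro c1; rewrite -[LHS]/(limn (symsum (periodized_kernel m b x))).
suff c2 : arithmetic_mean (symsum (periodized_kernel m b x)) n @[n --> \oo] -->
    (2 * pi)^-1 * symsum (fun k : int => ramp m (b * k%:~R) * cos (k%:~R * x)) K.
  exact: (cvg_unique _ c1 c2).
pose phi s := ramp m s * cos (s * (x / b)).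
have phiL s t : `|phi s - phi t| <= ((m * m)%:R + `|x / b|) * `|s - t|.
  exact: ramp_cos_lipschitz.
have cphi : continuous phi by exact: continuous_lipschitz phiL.
(* Left end of the union of the 2K+1 cells of length b centred at the points b k, |k| <= K. The
   cells cover [-2,2] because b K >= 2, and the ramp vanishes outside, so the integral splits into
   one Fejer integral per cell. *)
pose a := - (b * K%:R) - b / 2.
have split_int n : \int[mu]_(s in `[-2, 2]) (phi s * fejer n (s * (2 * pi / b))) =
    \sum_(k < K.*2.+1) \int[mu]_(s in `[b * (k%:Z - K%:Z)%:~R - b / 2,
      b * (k%:Z - K%:Z)%:~R - b / 2 + b]) (phi s * fejer n (s * (2 * pi / b))).
  have cF : continuous (fun s => phi s * fejer n (s * (2 * pi / b))).
    by move=> s; apply: cvgM; [exact: cphi|exact: continuous_fejer].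
  rewrite -(@Rintegral_supported _ _ (-2) 2); last first.
    move=> s s2; rewrite /phi -mulrA.
    exact: (@ramp_supported _ _ (fun s => cos (s * (x / b)) * fejer n (s * (2 * pi / b)))).
  rewrite (@Rintegral_supported _ _ a (a + b * K.*2.+1%:R)); last first.
    move=> s sa; rewrite /phi -mulrA.
    apply: (@ramp_supported _ _ (fun s => cos (s * (x / b)) * fejer n (s * (2 * pi / b)))) => //.
    apply: contra sa.
    rewrite !in_itv/= => /andP[s1 s2].
    rewrite /a -[K.*2.+1%:R]natr1 -addnn natrD; apply/andP; split; lra.
  rewrite Rintegral_itv_nat_split ?(ltW b0)//; apply: eq_bigr => k _.
  have -> // : a + b * k%:R = b * (k%:Z - K%:Z)%:~R - b / 2.
  by rewrite /a intrB -!pmulrn; ring.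
under eq_fun => n.
  rewrite (mean_periodized_kernel _ _ _ b0 : _ = (2 * pi * b)^-1 * (n.+1%:R^-1 *
    \int[mu]_(s in `[-2, 2]) (phi s * fejer n.+1 (s * (2 * pi / b))))).
  rewrite split_int mulr_sumr mulr_sumr.
  over.
have -> : (2 * pi)^-1 * symsum (fun k : int => ramp m (b * k%:~R) * cos (k%:~R * x)) K =
   \sum_(k < K.*2.+1) (2 * pi * b)^-1 *
    (b * phi (b * (k%:Z - K%:Z)%:~R)).
  rewrite /symsum mulr_sumr; apply: eq_bigr => k _; rewrite /phi.
  have b1 : b != 0 by rewrite gt_eqF.
  have pi0 : pi != 0 :> R by rewrite gt_eqF// pi_gt0.
  have -> : b * (k%:Z - K%:Z)%:~R * (x / b) = (k%:Z - K%:Z)%:~R * x by field.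
  by rewrite [(2 * pi * b)^-1]invfM -mulrA mulKf.
apply: cvg_sumr => k; apply: cvgM; first exact: cvg_cst.
by apply: fejer_cvg phiL => //; exists (k%:Z - K%:Z).
Qed.

Lemma window_ramp m b x (K : nat) : (2 <= m)%N -> 0 < b -> 2 <= b * K%:R ->
  window (flat_top_kernel (ramp m)) b x =
  ((2 * pi)^-1 * symsum (fun k : int => ramp m (b * k%:~R) * cos (k%:~R * x)) K)%:C.
Proof.
move=> m2 b0 bK; have m0 : (0 < m)%N by apply: leq_trans m2.
rewrite /window /czsum -poisson_ramp//.
have -> : (fun t : int => complex.Re (window_term (flat_top_kernel (ramp m)) b x t)) =
    periodized_kernel m b x.
  by apply/funext => t; rewrite window_term_ramp.
have -> : (fun t : int => complex.Im (window_term (flat_top_kernel (ramp m)) b x t)) = cst 0.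
  by apply/funext => t; rewrite window_term_ramp.
congr (_ +i* _); rewrite /zsum.
under eq_fun do rewrite big1//.
exact: lim_cst.
Qed.

End Poisson.

(** * Bias of the estimator at a fixed pair of arguments *)

Section Bias.
Context {R : realType}.
Implicit Types (x y theta omega phi b : R).

(** Multiplied by sin(alpha) for alpha = pi j / N, the sum telescopes, and the angles at its two
    ends differ by 2 pi j. The condition 0 < |j| < N ensures sin(alpha) <> 0. *)
Lemma sum_cos_equispaced N (j : int) theta : (0 < `|j| < N)%N ->
  \sum_(s < N) cos (theta + 2 * pi * s%:R / N%:R * j%:~R) = 0.
Proof.
move=> /andP[j0 jN]; pose alpha : R := pi * j%:~R / N%:R.
have n0 : (0 < N)%N by rewrite (leq_ltn_trans _ jN).
have N0 : 0 < N%:R :> R by rewrite ltr0n.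
have sa : sin alpha != 0.
  have h : 0 < sin (pi * `|j|%N%:R / N%:R :> R).
    apply: sin_gt0_pi; rewrite divr_gt0 ?mulr_gt0 ?pi_gt0 ?ltr0n//=.
    by rewrite ltr_pdivrMr// ltr_pM2l ?pi_gt0// ltr_nat.
  have : `|alpha| = pi * `|j|%N%:R / N%:R.
    rewrite /alpha !normrM normfV (gtr0_norm N0) (gtr0_norm (pi_gt0 R)).
    by rewrite -intr_norm -abszE -pmulrn.
  move=> ha; rewrite -ha in h.
  case: (ger0P alpha) h => _; first by move=> /gt_eqF ->.
  by rewrite sinN oppr_gt0 => /lt_eqF ->.
apply: (mulfI sa); rewrite mulr0.
pose f (s : nat) := sin (theta + 2 * alpha * s%:R - alpha) / 2.
rewrite mulr_sumr.
transitivity (\sum_(0 <= s < N) (f s.+1 - f s)).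
  rewrite big_mkord; apply: eq_bigr => s _; rewrite /f.
  have -> : 2 * pi * s%:R / N%:R * j%:~R = 2 * alpha * s%:R by rewrite /alpha; ring.
  set z := theta + 2 * alpha * s%:R.
  have -> : theta + 2 * alpha * s.+1%:R - alpha = z + alpha.
    by rewrite /z -[s.+1%:R]natr1; ring.
  by rewrite sinD sinB; field.
rewrite telescope_sumr// /f.
have -> : theta + 2 * alpha * N%:R - alpha = theta + 2 * alpha * 0 - alpha + j%:~R * (pi *+ 2).
  rewrite -mulr_natl /alpha; field; exact: lt0r_neq0.
by rewrite sinD2pi_int subrr.
Qed.

Lemma mean_cst N (x : R) : N%:R != 0 :> R -> N%:R^-1 * (x *+ N) = x.
Proof. by move=> N0; rewrite -[x *+ N]mulr_natl mulKf. Qed.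

(* The value of the window, provided that [2 <= b * K%:R]. *)
Definition window_sum m b K x : R :=
  (2 * pi)^-1 * symsum (fun k : int => ramp m (b * k%:~R) * cos (k%:~R * x)) K.

Lemma symsum_even_cos (c : int -> R) n x y : (forall k, c (- k) = c k) ->
  symsum (fun k : int => c k * cos (k%:~R * x)) n * cos y =
  symsum (fun k : int => c k * cos (k%:~R * x + y)) n.
Proof.
move=> cN; pose h := symsum (fun k : int => c k * sin (k%:~R * x)) n.
have h0 : h = 0.
  have : h = - h.
    rewrite /h -[LHS]symsumN -mulN1r -symsumZ; apply: eq_symsum => j _.
    by rewrite cN mulrNz mulNr sinN mulN1r mulrN.
  lra.
transitivity (cos y * symsum (fun k : int => c k * cos (k%:~R * x)) n - sin y * h).
  by rewrite h0 mulr0 subr0 mulrC.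
by rewrite /h -!symsumZ -symsumB; apply: eq_symsum => k _; rewrite cosD; ring.
Qed.

Lemma symsum_delta (g : int -> R) (j : int) n :
  (forall k, k != j -> g k = 0) -> ((n < `|j|)%N -> g j = 0) -> symsum g n = g j.
Proof.
move=> gj gn; rewrite -big_symseq; have [jn|jn] := leqP `|j|%N n.
  rewrite (bigD1_seq j) ?uniq_symseq ?mem_symseq//= big1 ?addr0// => k; exact: gj.
by rewrite gn// big1// => k _; case: (eqVneq k j) => [->|/gj //]; rewrite gn.
Qed.

Lemma ramp_eq0_mul m b (K : nat) (j : int) : (0 < m)%N -> 0 < b -> 2 <= b * K%:R ->
  (K < `|j|)%N -> ramp m (b * j%:~R) = 0.
Proof.
move=> m0 b0 bK Kj; apply: ramp_eq0 => //; rewrite normrM (gtr0_norm b0).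
rewrite (le_trans bK)// ler_wpM2l ?(ltW b0)// -intr_norm -abszE -pmulrn.
by rewrite ler_nat ltnW.
Qed.

(** Discrete orthogonality: |k| <= K < N/2 and |j| <= N/2 give |j - k| < N, so only k = j survives.
    If |j| > K nothing survives, and the right side vanishes too since b |j| >= 2. *)
Lemma sum_window_sum m b (K N : nat) (j : int) omega phi :
  (0 < m)%N -> 0 < b -> 2 <= b * K%:R -> (K.*2 < N)%N -> (`|j|.*2 <= N)%N ->
  N%:R^-1 * \sum_(s < N) window_sum m b K (omega - 2 * pi * s%:R / N%:R) *
    cos (2 * pi * s%:R / N%:R * j%:~R + phi) =
  (2 * pi)^-1 * (ramp m (b * j%:~R) * cos (j%:~R * omega + phi)).
Proof.
move=> m0 b0 bK KN jN.
have N0 : N%:R != 0 :> R by rewrite pnatr_eq0 -lt0n (leq_ltn_trans _ KN).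
have cE (s : nat) : window_sum m b K (omega - 2 * pi * s%:R / N%:R) *
    cos (2 * pi * s%:R / N%:R * j%:~R + phi) =
    (2 * pi)^-1 * symsum (fun k : int => ramp m (b * k%:~R) *
      cos (k%:~R * omega + phi + 2 * pi * s%:R / N%:R * (j - k)%:~R)) K.
  rewrite /window_sum -[LHS]mulrA; congr (_ * _).
  rewrite symsum_even_cos; last by move=> k; rewrite mulrNz mulrN rampN.
  by apply: eq_symsum => k _; congr (_ * cos _); rewrite intrB; ring.
under eq_bigr do rewrite cE.
rewrite -mulr_sumr mulrCA; congr (_ * _).
rewrite /symsum exchange_big/=.
rewrite -[X in _ * X]/(symsum (fun k : int => \sum_(s < N) (ramp m (b * k%:~R) *
  cos (k%:~R * omega + phi + 2 * pi * s%:R / N%:R * (j - k)%:~R))) K).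
rewrite -symsumZ.
have g0 (k : int) : (`|k| <= K)%N -> k != j -> \sum_(s < N) (ramp m (b * k%:~R) *
    cos (k%:~R * omega + phi + 2 * pi * s%:R / N%:R * (j - k)%:~R)) = 0.
  by move=> kK kj; rewrite -mulr_sumr sum_cos_equispaced ?mulr0//; lia.
transitivity (symsum (fun k : int => if k == j then
    ramp m (b * k%:~R) * cos (k%:~R * omega + phi) else 0) K).
  apply: eq_symsum => k kK; case: eqVneq => [->|kj]; last by rewrite g0// mulr0.
  under eq_bigr do rewrite subrr mulr0 addr0.
  by rewrite sumr_const card_ord mean_cst.
rewrite (@symsum_delta _ j) ?eqxx//; first by move=> k /negPf ->.
by move=> Kj; rewrite (ramp_eq0_mul m0 b0 bK)// mul0r.
Qed.

Lemma window_sum_bound m b K x : 0 < b <= 1 -> b * K%:R <= 3 ->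
  `|window_sum m b K x| <= 7 / b.
Proof.
move=> /andP[b0 b1] bK; rewrite /window_sum normrM.
(* The 2K+1 terms are at most 1 each, and b (2K + 1) <= 6 + 1, whence the 7. *)
have h : `|symsum (fun k : int => ramp m (b * k%:~R) * cos (k%:~R * x)) K| <= K.*2.+1%:R.
  apply: le_trans (ler_symsum_norm _ _) _.
  rewrite -[K.*2.+1]card_ord -sumr_const; apply: ler_sum => k _.
  have /andP[r0 r1] := ramp_itv m (b * (k%:Z - K%:Z)%:~R).
  by rewrite normrM ger0_norm// mulr_ile1// cos_max.
have h2 : `|(2 * pi)^-1| <= 1 :> R.
  rewrite ger0_norm ?invr_ge0 ?mulr_ge0 ?pi_ge0// invf_le1 ?mulr_gt0 ?pi_gt0//.
  by have := @pi_ge2 R; lra.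
apply: le_trans (ler_pM _ _ h2 h) _ => //; rewrite mul1r ler_pdivlMr//.
rewrite -[K.*2.+1%:R]natr1 -addnn natrD; lra.
Qed.

(* [phi = 0] gives the real part of the estimator and [phi = pi / 2] its imaginary part. *)
Definition spectral_weight m b (K N : nat) omega phi (j : int) : R :=
  N%:R^-1 * \sum_(1 <= s < N) window_sum m b K (omega - 2 * pi * s%:R / N%:R) *
    cos (2 * pi * s%:R / N%:R * j%:~R + phi).

Lemma ler_norm_expr (p : nat) (j : int) : (0 < p)%N ->
  (`|j|%N%:R : R) <= `|j|%N%:R ^+ p.
Proof. by move=> p0; rewrite -natrX ler_nat; case: `|j|%N => // n; rewrite -{1}[n.+1]expn1 leq_pexp2l. Qed.

Lemma spectral_weight_bias m b (K N p : nat) omega phi (j : int) :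
  (0 < m)%N -> (0 < p)%N -> 0 < b <= 1 -> 2 <= b * K%:R <= 3 -> (K.*2 < N)%N ->
  (`|j| < N)%N ->
  `|spectral_weight m b K N omega phi j - (2 * pi)^-1 * cos (j%:~R * omega + phi)|
  <= 16 * (b ^+ p + b^-1 * N%:R^-1) * (1 + `|j|%N%:R ^+ p).
Proof.
move=> m0 p0 /[dup] b01 /andP[b0 b1] /andP[bK1 bK2] KN jN.
have N0 : 0 < N%:R :> R by rewrite ltr0n (leq_ltn_trans _ jN).
have n1 : (0 < N)%N by rewrite (leq_ltn_trans _ jN).
have bV : 1 <= b^-1 by rewrite invf_ge1.
have bNV : 0 <= b^-1 * N%:R^-1 by rewrite mulr_ge0 ?invr_ge0 ?(ltW b0).
have bp : 0 <= b ^+ p by rewrite exprn_ge0 ?(ltW b0).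
have jp := ler_norm_expr j p0.
have jp0 : 0 <= `|j|%N%:R :> R by [].
have h2 : 0 <= (2 * pi : R)^-1 <= 1.
  rewrite invr_ge0 ?mulr_ge0 ?pi_ge0//= invf_le1 ?mulr_gt0 ?pi_gt0//.
  by have := @pi_ge2 R; lra.
have /andP[h20 h21] := h2.
(* Low lags: orthogonality is exact once the frequency s = 0, absent from the estimator, is put
   back; taking it out again costs at most 7/(bN). *)
have [jN2|jN2] := leqP `|j|.*2 N.
  have -> : spectral_weight m b K N omega phi j =
      (2 * pi)^-1 * (ramp m (b * j%:~R) * cos (j%:~R * omega + phi)) -
      N%:R^-1 * (window_sum m b K omega * cos phi).
    rewrite -(sum_window_sum omega phi m0 b0 bK1 KN jN2) /spectral_weight.
    rewrite -mulrBr; congr (_ * _).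
    rewrite -(big_mkord xpredT (fun s => window_sum m b K (omega - 2 * pi * s%:R / N%:R) *
      cos (2 * pi * s%:R / N%:R * j%:~R + phi))) big_ltn//.
    by rewrite mulr0 mul0r mul0r subr0 add0r [_ + \sum_(_ <= _ < _) _]addrC addrK.
  rewrite addrAC -mulrBr -{2}[cos (_ + phi)]mul1r -mulrBl.
  (* For b |j| <= 1 the ramp is flat and the error is 0; otherwise the error is at most 1 <= (b
     |j|)^p. *)
  have rb : `|ramp m (b * j%:~R) - 1| <= b ^+ p * `|j|%N%:R ^+ p.
    have bjE : `|b * j%:~R| = b * `|j|%N%:R.
      by rewrite normrM (gtr0_norm b0) -intr_norm -abszE -pmulrn.
    have [bj1|/ltW bj1] := leP `|b * j%:~R| 1.
      by rewrite ramp_eq1// subrr normr0 -exprMn exprn_ge0// mulr_ge0// ltW.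
    have /andP[r0 r1] := ramp_itv m (b * j%:~R).
    rewrite bjE in bj1; rewrite -exprMn (@le_trans _ _ 1) ?exprn_ege1//.
    by rewrite ler_norml; lra.
  have A1 : `|(2 * pi)^-1 * ((ramp m (b * j%:~R) - 1) * cos (j%:~R * omega + phi))|
      <= b ^+ p * `|j|%N%:R ^+ p.
    rewrite normrM (ger0_norm h20) -[leRHS]mul1r ler_pM//.
    by rewrite normrM -[leRHS]mulr1 ler_pM// cos_max.
  have A2 : `|N%:R^-1 * (window_sum m b K omega * cos phi)| <= 7 * (b^-1 * N%:R^-1).
    rewrite normrM normfV (gtr0_norm N0) mulrC mulrA ler_wpM2r ?invr_ge0//.
    by rewrite normrM -[leRHS]mulr1 ler_pM ?cos_max// window_sum_bound.
  apply: le_trans (ler_normB _ _) _; apply: le_trans (lerD A1 A2) _.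
  have q0 : 0 <= `|j|%N%:R ^+ p :> R by rewrite exprn_ge0.
  have := mulr_ge0 bp q0; have := mulr_ge0 bNV q0; nra.
(* High lags: orthogonality may fail, so both terms are bounded crudely, by 8/b together. Since 1 <=
   2 |j| / N, this is at most 16 |j| / (bN). *)
have A1 : `|spectral_weight m b K N omega phi j| <= 7 / b.
  rewrite /spectral_weight normrM normfV (gtr0_norm N0) mulrC ler_pdivrMr//.
  apply: le_trans (ler_norm_sum _ _ _) _.
  apply: (@le_trans _ _ (\sum_(1 <= s < N) 7 / b)).
    apply: ler_sum => s _; rewrite normrM -[leRHS]mulr1 ler_pM ?cos_max//.
    exact: window_sum_bound.
  by rewrite sumr_const_nat -[leLHS]mulr_natr ler_wpM2l ?divr_ge0 ?(ltW b0)// ler_nat leq_subr.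
have A2 : `|(2 * pi)^-1 * cos (j%:~R * omega + phi)| <= b^-1.
  rewrite normrM (ger0_norm h20) (le_trans _ bV)// -[leRHS]mul1r ler_pM ?cos_max//.
apply: le_trans (ler_normB _ _) _; apply: le_trans (lerD A1 A2) _.
have jN3 : 1 <= 2 * `|j|%N%:R / N%:R :> R.
  by rewrite ler_pdivlMr// mul1r -natrM ler_nat mul2n ltnW.
have h8 : 0 <= 8 * b^-1 by rewrite mulr_ge0// (le_trans _ bV).
have := ler_wpM2l h8 jN3; rewrite mulr1.
have -> : 8 * b^-1 * (2 * `|j|%N%:R / N%:R) = 16 * (b^-1 * N%:R^-1) * `|j|%N%:R by ring.
have := ler_wpM2l bNV jp; have q0 : 0 <= `|j|%N%:R ^+ p :> R by rewrite exprn_ge0.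
have := mulr_ge0 bp q0; nra.
Qed.

Lemma sum_ltn_le (n N : nat) : \sum_(i < N) (i < n)%:R <= n%:R :> R.
Proof.
suff -> : \sum_(i < N) (i < n)%:R = (minn n N)%:R :> R by rewrite ler_nat geq_minl.
elim: N => [|N IH]; first by rewrite big_ord0 minn0.
rewrite big_ord_recr/= IH -natrD; congr _%:R; lia.
Qed.

(** Each lag k is missing from at most |k| of the partial sums of index i < N. This accounts for the
    triangular factor without writing it. *)
Lemma sum_symsum_tail (a : int -> R) N M : (forall k, 0 <= a k) -> (N <= M)%N ->
  \sum_(i < N) (symsum a M - symsum a i) <= symsum (fun k => `|k|%N%:R * a k) M.
Proof.
move=> a0 NM.
have tailE (i : 'I_N) : symsum a M - symsum a i =
    symsum (fun k : int => (i < `|k|)%N%:R * a k) M.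
  have iM : (i <= M)%N by rewrite (leq_trans _ NM)// ltnW.
  have -> : symsum a i = symsum (fun k : int => (`|k| <= i)%N%:R * a k) M.
    rewrite (@symsum_finite _ _ i M)//; last by move=> k; rewrite ltnNge => /negPf ->; rewrite mul0r.
    by apply: eq_symsum => k ->; rewrite mul1r.
  rewrite -symsumB; apply: eq_symsum => k _.
  by rewrite ltnNge; case: leqP => _; rewrite ?mul0r ?mul1r ?subrr ?subr0.
under eq_bigr do rewrite tailE.
rewrite /symsum exchange_big/=; apply: ler_sum => k _.
by rewrite -mulr_suml ler_wpM2r// sum_ltn_le.
Qed.

Lemma normr_symsumB (a : int -> R) i M : (i <= M)%N ->
  `|symsum a i - symsum a M| <= symsum (fun k => `|a k|) M - symsum (fun k => `|a k|) i.
Proof.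
elim: M => [|M IH]; first by rewrite leqn0 => /eqP ->; rewrite !subrr normr0.
rewrite leq_eqVlt => /predU1P[->|]; first by rewrite !subrr normr0.
rewrite ltnS => /IH h; rewrite !symsumS opprD addrA.
apply: le_trans (ler_normB _ _) _; rewrite addrAC lerD//.
exact: ler_normD.
Qed.

(** The double sum is a sum of symmetric partial sums of index i < N, and each is compared with the
    whole series. With e = b^p + 1/(bN), this costs 16 e G for the weights plus a tail; the tails
    add up to at most G, hence to G/N <= e G on average. *)
Lemma estimator_bias m b (K N p : nat) omega phi (r : int -> R) (G : R) :
  (0 < m)%N -> (0 < p)%N -> 0 < b <= 1 -> 2 <= b * K%:R <= 3 -> (K.*2 < N)%N ->
  (forall n, symsum (fun k => (1 + `|k|%N%:R ^+ p) * `|r k|) n <= G) ->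
  `|N%:R^-1 * \sum_(t < N) \sum_(u < N)
       (spectral_weight m b K N omega phi (t%:Z - u%:Z) * r (t%:Z - u%:Z)) -
    (2 * pi)^-1 * zsum (fun k : int => cos (k%:~R * omega + phi) * r k)|
  <= 17 * (b ^+ p + b^-1 * N%:R^-1) * G.
Proof.
move=> m0 p0 b01 bK KN rG; have /andP[b0 b1] := b01.
have N0 : 0 < N%:R :> R by rewrite ltr0n (leq_ltn_trans _ KN).
have bV : 1 <= b^-1 by rewrite invf_ge1.
set e := b ^+ p + b^-1 * N%:R^-1.
have e0 : 0 <= e by rewrite addr_ge0 ?exprn_ge0 ?mulr_ge0 ?invr_ge0// ltW.
have NVe : N%:R^-1 <= e.
  rewrite -[leLHS]mul1r (@le_trans _ _ (b^-1 * N%:R^-1)) ?ler_wpM2r ?invr_ge0//.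
  by rewrite lerDr exprn_ge0// ltW.
have h20 : 0 <= (2 * pi)^-1 :> R by rewrite invr_ge0 ?mulr_ge0 ?pi_ge0.
have h21 : (2 * pi)^-1 <= 1 :> R.
  rewrite invf_le1 ?mulr_gt0 ?pi_gt0//.
  by have := @pi_ge2 R; lra.
pose g k := (2 * pi)^-1 * (cos (k%:~R * omega + phi) * r k).
pose W := spectral_weight m b K N omega phi.
have wr0 k : 0 <= (1 + `|k|%N%:R ^+ p) * `|r k|.
  by rewrite mulr_ge0// addr_ge0// exprn_ge0.
have G0 : 0 <= G by apply: le_trans (rG 0%N); exact: symsum_ge0.
have cr n : symsum (fun k => `|cos (k%:~R * omega + phi) * r k|) n <= G.
  apply: le_trans (rG n); apply: ler_symsum => k _.
  rewrite normrM ler_wpM2r// (le_trans (cos_max _))// lerDl exprn_ge0//.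
have gr k : `|g k| <= `|r k|.
  rewrite /g !normrM (ger0_norm h20) -[leRHS]mul1r ler_pM ?mulr_ge0//.
  by rewrite -[leRHS]mul1r ler_pM// cos_max.
(* The series is first cut at M >= N, so that only finite sums are compared; M goes to infinity at
   the end. *)
have key M : (N <= M)%N ->
    `|N%:R^-1 * \sum_(i < N) symsum (fun k => W k * r k) i - symsum g M| <= 17 * e * G.
  move=> NM.
  have -> : N%:R^-1 * \sum_(i < N) symsum (fun k => W k * r k) i - symsum g M =
      N%:R^-1 * \sum_(i < N) (symsum (fun k => W k * r k) i - symsum g M).
    by rewrite sumrB sumr_const card_ord mulrBr mean_cst// lt0r_neq0.
  have Ai (i : 'I_N) : `|symsum (fun k => W k * r k) i - symsum g M| <=
      16 * e * G + (symsum (fun k => `|r k|) M - symsum (fun k => `|r k|) i).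
    have iM : (i <= M)%N by rewrite (leq_trans _ NM)// ltnW.
    rewrite -(subrKA (symsum g i)); apply: le_trans (ler_normD _ _) _; apply: lerD.
      rewrite -symsumB; apply: le_trans (ler_symsum_norm _ _) _.
      apply: le_trans (_ : _ <= 16 * e * symsum (fun k => (1 + `|k|%N%:R ^+ p) * `|r k|) i) _.
        rewrite -symsumZ; apply: ler_symsum => k ki.
        rewrite /g mulrA -mulrBl normrM mulrA ler_wpM2r//.
        apply: spectral_weight_bias => //.
        exact: leq_ltn_trans ki (ltn_ord i).
      by rewrite ler_wpM2l// mulr_ge0.
    apply: le_trans (normr_symsumB _ iM) _.
    (* As |g| <= |r| termwise, the symmetric sums of |r| - |g| increase, so a tail of |g| is at most
       the same tail of |r|. *)
    have h : symsum (fun k => `|r k| - `|g k|) i <= symsum (fun k => `|r k| - `|g k|) M.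
      by apply: ler_symsum_widen => // k; rewrite subr_ge0.
    by rewrite !symsumB in h; lra.
  rewrite normrM normfV (gtr0_norm N0) mulrC ler_pdivrMr//.
  apply: le_trans (ler_norm_sum _ _ _) _.
  apply: le_trans (ler_sum _ (fun i _ => Ai i)) _.
  rewrite big_split/= sumr_const card_ord -[_ *+ N]mulr_natr.
  have tail : \sum_(i < N) (symsum (fun k => `|r k|) M - symsum (fun k => `|r k|) i) <= G.
    apply: le_trans (sum_symsum_tail (fun k => normr_ge0 _) NM) _.
    apply: le_trans (rG M); apply: ler_symsum => k _; rewrite ler_wpM2r//.
    by rewrite (le_trans (ler_norm_expr k p0))// lerDr.
  have eN : 1 <= e * N%:R by rewrite -ler_pdivrMr// mul1r.
  apply: le_trans (lerD (lexx _) tail) _.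
  have := ler_wpM2r G0 eN; rewrite mul1r; lra.
rewrite (sum_sum_symsum (fun k => W k * r k)).
apply/ler_addgt0Pr => eps eps0.
have cg : symsum g M @[M --> \oo] -->
    (2 * pi)^-1 * zsum (fun k : int => cos (k%:~R * omega + phi) * r k).
  rewrite /g; under eq_fun do rewrite symsumZ.
  by apply: cvgM; [exact: cvg_cst|exact: is_cvg_symsum cr].
near \oo => M.
have NM : (N <= M)%N by near: M; exact: nbhs_infty_ge.
rewrite -(subrKA (symsum g M)); apply: le_trans (ler_normD _ _) _.
apply: lerD; first exact: key.
rewrite distrC; near: M; move/cvgrPdist_le : cg; exact.
Unshelve. all: end_near. Qed.

End Bias.

(** * Norms on the unit square *)

Section MeasureTools.
Context d (T : measurableType d) (R : realType) (mu : {measure set T -> \bar R}).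
Local Open Scope ereal_scope.

Import HBNNSimple.

(* The smaller function need not be measurable: its integral is a supremum over the
   simple functions below it. *)
Lemma le_integral_nonmeasurable (f g : T -> \bar R) :
  (forall x, 0 <= f x) -> (forall x, 0 <= g x) -> measurable_fun setT g ->
  {ae mu, forall x, f x <= g x} -> \int[mu]_x f x <= \int[mu]_x g x.
Proof.
move=> f0 g0 mg fg; rewrite (ge0_integralTE mu f0); apply: ge_ereal_sup.
move=> _ [h hf <-]; rewrite -[X in sintegral _ X](@patch_setT _ _ (cst 0%R)).
rewrite -integral_nnsfun//; apply: ae_ge0_le_integral => //.
- by move=> x _; rewrite lee_fin.
- exact/measurable_EFinP.
- by move: fg; apply: filterS => x fgx _; exact: le_trans (hf x) fgx.
Qed.

Lemma Lnorm2E (f : T -> R) :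
  'N[mu]_2%:E[EFin \o f] = (\int[mu]_x (f x ^+ 2)%:E) `^ (2^-1)%R.
Proof.
rewrite unlock /Lnorm; congr (_ `^ _); apply: eq_integral => x _ /=.
by rewrite powR_mulrn// real_normK// num_real.
Qed.

Let I0 (f : T -> R) : 0 <= \int[mu]_x (f x ^+ 2)%:E.
Proof. by apply: integral_ge0 => x _; rewrite lee_fin sqr_ge0. Qed.

Lemma integral_le_Lnorm2 (f : T -> R) (c : R) : (0 <= c)%R ->
  \int[mu]_x (f x ^+ 2)%:E <= (c ^+ 2)%:E -> 'N[mu]_2%:E[EFin \o f] <= c%:E.
Proof.
move=> c0 h; rewrite Lnorm2E.
have -> : c%:E = (c ^+ 2)%:E `^ (2^-1)%R.
  by rewrite poweR_EFin -powR_mulrn// -powRrM mulfV ?powRr1.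
by apply: gt0_ler_poweR => //; rewrite in_itv/= ?leey ?andbT ?lee_fin ?sqr_ge0 ?I0.
Qed.

Lemma Lnorm2_le_integral (f : T -> R) (c : R) : (0 <= c)%R ->
  'N[mu]_2%:E[EFin \o f] <= c%:E -> \int[mu]_x (f x ^+ 2)%:E <= (c ^+ 2)%:E.
Proof.
move=> c0; rewrite Lnorm2E => h.
have -> : (c ^+ 2)%:E = c%:E `^ 2%R by rewrite poweR_EFin powR_mulrn.
rewrite -[leLHS]poweRe1// -[X in _ `^ X](@mulVf _ 2%R)// poweRrM.
by apply: gt0_ler_poweR => //; rewrite in_itv/= ?leey ?andbT ?lee_fin ?poweR_ge0.
Qed.

Lemma Lnorm2Z (f : T -> R) (c : R) : (0 <= c)%R -> measurable_fun setT f ->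
  'N[mu]_2%:E[EFin \o (fun x => c * `|f x|)%R] = c%:E * 'N[mu]_2%:E[EFin \o f].
Proof.
move=> c0 mf; rewrite !Lnorm2E.
under eq_integral do rewrite exprMn real_normK ?num_real// EFinM.
rewrite ge0_integralZl//.
- by rewrite poweRM ?lee_fin ?sqr_ge0 ?I0// poweR_EFin -powR_mulrn// -powRrM mulfV ?powRr1.
- by apply/measurable_EFinP; exact: measurable_funX.
- by move=> x _; rewrite lee_fin sqr_ge0.
- by rewrite lee_fin sqr_ge0.
Qed.

Lemma Lnorm2_sum (I : Type) (s : seq I) (f : I -> T -> R) :
  (forall i, measurable_fun setT (f i)) ->
  'N[mu]_2%:E[EFin \o (fun x => \sum_(i <- s) f i x)%R] <=
  \sum_(i <- s) 'N[mu]_2%:E[EFin \o f i].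
Proof.
move=> mf; elim: s => [|i s IH].
  rewrite big_nil; under [X in _ \o X]eq_fun do rewrite big_nil.
  by rewrite (_ : _ \o _ = cst 0) ?Lnorm0// eqe.
rewrite big_cons; apply: le_trans (leeD2l _ IH).
under [X in _ \o X]eq_fun do rewrite big_cons.
apply: (@minkowski_EFin _ _ _ mu (f i) (fun x => \sum_(j <- s) f j x)%R) => //.
  by apply: measurable_sum.
by rewrite ler1n.
Qed.

Lemma measurable_symsum (rho : int -> T -> R) n :
  (forall k, measurable_fun setT (rho k)) ->
  measurable_fun setT (fun x => symsum (rho ^~ x) n).
Proof. by move=> mrho; apply: measurable_sum => k. Qed.

Lemma Lnorm2_symsum (rho : int -> T -> R) (w : int -> R) n :
  (forall k, measurable_fun setT (rho k)) -> (forall k, (0 <= w k)%R) ->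
  'N[mu]_2%:E[EFin \o (fun x => symsum (fun k => (w k * `|rho k x|)%R) n)] <=
  \sum_(k <- symseq n) (w k)%:E * 'N[mu]_2%:E[EFin \o rho k].
Proof.
move=> mrho w0.
have -> : (fun x => symsum (fun k => (w k * `|rho k x|)%R) n) =
    (fun x => \sum_(k <- symseq n) (w k * `|rho k x|))%R.
  by apply/funext => x; rewrite big_symseq.
apply: le_trans (Lnorm2_sum _ _) _.
  by move=> k; apply: measurable_funM => //; exact: measurableT_comp.
by apply: lee_sum => k _; rewrite Lnorm2Z.
Qed.

(** h is not assumed measurable, and the pointwise bound says nothing where the weighted series
    diverges. Minkowski bounds the partial sums, and monotone convergence of their squares passes to
    the limit. *)
Lemma Lnorm2_dominated (rho : int -> T -> R) (w : int -> R) (h : T -> R) (c S : R) :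
  (forall k, measurable_fun setT (rho k)) -> (forall k, (0 <= w k)%R) ->
  (0 < c)%R -> (0 <= S)%R ->
  (forall n, \sum_(k <- symseq n) (w k)%:E * 'N[mu]_2%:E[EFin \o rho k] <= S%:E) ->
  {ae mu, forall x, forall G : R,
    (forall n, symsum (fun k => w k * `|rho k x|) n <= G)%R -> (`|h x| <= c * G)%R} ->
  'N[mu]_2%:E[EFin \o h] <= (c * S)%:E.
Proof.
move=> mrho w0 c0 S0 wS hG.
have c0' := ltW c0.
pose g n x := (c * symsum (fun k => w k * `|rho k x|) n)%R.
have g0 n x : (0 <= g n x)%R.
  by rewrite mulr_ge0// symsum_ge0// => k; rewrite mulr_ge0.
have mg n : measurable_fun setT (g n).
  apply: measurable_funM => //; apply: measurable_symsum => k.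
  by apply: measurable_funM => //; exact: measurableT_comp.
have ndg x n m : (n <= m)%N -> (g n x <= g m x)%R.
  by move=> nm; rewrite ler_wpM2l// ler_symsum_widen// => k; rewrite mulr_ge0.
pose f n x := ((g n x) ^+ 2)%:E.
have f0 n x : 0 <= f n x by rewrite lee_fin sqr_ge0.
have mf n : measurable_fun setT (f n).
  by apply/measurable_EFinP; exact: measurable_funX.
have ndf x : {homo f ^~ x : n m / (n <= m)%N >-> n <= m}.
  by move=> n m nm; rewrite lee_fin ler_sqr ?nnegrE// ndg.
have cf x : cvgn (f ^~ x) by exact: ereal_nondecreasing_is_cvgn.
apply: integral_le_Lnorm2; first by rewrite mulr_ge0.
apply: (@le_trans _ _ (\int[mu]_x limn (f ^~ x))).
  apply: le_integral_nonmeasurable.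
  - by move=> x; rewrite lee_fin sqr_ge0.
  - by move=> x; apply: lime_ge => //; exact: nearW.
  - exact: (emeasurable_fun_cvg _ _ mf (fun x _ => cf x)).
  move: hG; apply: filterS => x hG.
  have fn n : f n x <= limn (f ^~ x).
    have /cvg_lim -> // := ereal_nondecreasing_cvgn (ndf x).
    by apply: ereal_sup_ubound; exists n.
  (* An infinite limit makes the bound trivial. For a finite limit r the weighted partial sums are
     at most sqrt(r)/c, which serves as G. *)
  case E : (limn (f ^~ x)) fn => [r| |] fn; last 2 first.
  - by rewrite leey.
  - by have := le_trans (f0 0%N x) (fn 0%N).
  have r0 : (0 <= r)%R by rewrite -lee_fin (le_trans (f0 0%N x)).
  rewrite lee_fin -[leRHS]sqr_sqrtr// -[leLHS]real_normK ?num_real//.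
  rewrite ler_sqr ?nnegrE ?sqrtr_ge0//.
  have -> : Num.sqrt r = (c * (Num.sqrt r / c))%R by rewrite mulrC divfK ?gt_eqF.
  apply: hG => n; rewrite ler_pdivlMr// mulrC.
  rewrite -/(g n x) -(ger0_norm (g0 n x)) -sqrtr_sqr ler_wsqrtr// -lee_fin.
  exact: fn.
rewrite monotone_convergence//.
apply: lime_le.
  apply: ereal_nondecreasing_is_cvgn => n m nm; apply: ge0_le_integral => // x _.
  exact: ndf.
apply: nearW => n; apply: Lnorm2_le_integral; first by rewrite mulr_ge0.
have -> : g n = (fun x => c * `|symsum (fun k => w k * `|rho k x|) n|)%R.
  apply/funext => x; rewrite [in RHS]ger0_norm// symsum_ge0// => k.
  by rewrite mulr_ge0.
rewrite Lnorm2Z//; last first.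
  apply: measurable_symsum => k.
  by apply: measurable_funM => //; exact: measurableT_comp.
by rewrite EFinM lee_pmul2l ?lte_fin// (le_trans (Lnorm2_symsum _ _ _)).
Qed.

End MeasureTools.

(** Integrability of the sections is not assumed: Tonelli treats the positive and negative parts
    separately. Covariances and cumulants are thus measurable everywhere, including where the
    moments fail to exist. *)
Lemma measurable_Rintegral_snd d1 d2 (T1 : measurableType d1) (T2 : measurableType d2)
    (R : realType) (P : {sigma_finite_measure set T2 -> \bar R}) (f : T1 * T2 -> R) :
  measurable_fun setT f -> measurable_fun setT (fun x => \int[P]_y f (x, y)).
Proof.
move=> mf; have mF : measurable_fun setT (EFin \o f) by exact/measurable_EFinP.
rewrite /Rintegral; apply: (measurableT_comp (fine_measurable _)) => //.
have -> : (fun x => \int[P]_y (f (x, y))%:E)%E = (fun x =>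
    (\int[P]_y (EFin \o f)^\+ (x, y))%E - (\int[P]_y (EFin \o f)^\- (x, y))%E)%E.
  apply/funext => x; rewrite integralE; congr (_ - _)%E.
  - by apply: eq_integral => y _; rewrite !funeposE.
  - by apply: eq_integral => y _; rewrite !funenegE.
apply: emeasurable_funB.
- apply: (@measurable_fun_fubini_tonelli_F _ _ _ _ R P ((EFin \o f)^\+)%E).
    exact: measurable_funepos.
  by move=> z; exact: funepos_ge0.
- apply: (@measurable_fun_fubini_tonelli_F _ _ _ _ R P ((EFin \o f)^\-)%E).
    exact: measurable_funeneg.
  by move=> z; exact: funeneg_ge0.
Qed.

(** * The unit square as a product and as a space of pairs *)

Section UnitSquare.
Context {R : realType}.
Local Notation mu2 := (@leb01 R \x @leb01 R)%E.

Definition pair_tuple (z : measurableTypeR R * measurableTypeR R) :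
  2.-tuple (measurableTypeR R) := [tuple z.1; z.2].

Lemma measurable_pair_tuple : measurable_fun setT pair_tuple.
Proof.
apply/measurable_fun_tnthP => i.
have [->|->] : i = ord0 \/ i = ord_max.
  by case: i => -[|[|//]] h; [left|right]; exact: val_inj.
- by rewrite (_ : _ \o _ = fst)//; apply/funext => z; rewrite /= (tnth_nth 0).
- by rewrite (_ : _ \o _ = snd)//; apply/funext => z; rewrite /= (tnth_nth 0).
Qed.

Lemma measurable_singleton_tuple :
  measurable_fun setT (fun x : measurableTypeR R => [tuple x]).
Proof.
apply/measurable_fun_tnthP => i; rewrite ord1.
by rewrite (_ : _ \o _ = id)//; apply/funext => z; rewrite /= (tnth_nth 0).
Qed.

(** The innermost factor of [leb01_pow] is the Dirac mass at the empty tuple, so integrating it out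
    evaluates an indicator. *)
Lemma leb01_pow1E (A : set (1.-tuple (measurableTypeR R))) : measurable A ->
  leb01_pow 1 A = leb01 [set x | A [tuple x]].
Proof.
move=> mA; rewrite /= /distribution /pushforward /= /product_measure1 /=.
have mB : measurable [set x : measurableTypeR R | A [tuple x]].
  by rewrite -[X in measurable X]setTI; exact: measurable_singleton_tuple.
transitivity (\int[@leb01 R]_x (\1_[set x | A [tuple x]] x)%:E)%E.
  apply: eq_integral => x _; rewrite /= diracE indicE; congr ((nat_of_bool _)%:R%:E).
  apply/idP/idP; rewrite !inE /xsection/= ?inE/=.
    by congr A; exact: val_inj.
  by congr A; exact: val_inj.
by rewrite integral_indic// setIT.
Qed.

Lemma leb01_pow2E (A : set (2.-tuple (measurableTypeR R))) : measurable A ->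
  leb01_pow 2 A = mu2 (pair_tuple @^-1` A).
Proof.
move=> mA; pose c (z : measurableTypeR R * 1.-tuple (measurableTypeR R)) :
  2.-tuple (measurableTypeR R) := cons_tuple z.1 z.2.
have mc : measurable (c @^-1` A).
  by rewrite -[X in measurable X]setTI; apply: measurable_cons.
rewrite -[LHS]/((@leb01 R \x leb01_pow 1)%E (c @^-1` A)) /product_measure1.
apply: eq_integral => x _.
rewrite -[LHS]/(leb01_pow 1 (xsection (c @^-1` A) x)) leb01_pow1E; last first.
  exact: measurable_xsection.
congr (leb01 _); apply/seteqP; split => y; rewrite /xsection/= !inE/=.
Qed.

Lemma ae_leb01_pow2 (Q : 2.-tuple R -> Prop) :
  {ae leb01_pow 2, forall u, Q u} -> {ae mu2, forall z, Q (pair_tuple z)}.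
Proof.
move=> [A [mA A0 QA]]; exists (pair_tuple @^-1` A); split.
- by rewrite -[X in measurable X]setTI; exact: measurable_pair_tuple.
- by rewrite -leb01_pow2E.
- by move=> z /= Qz; apply: QA.
Qed.

Lemma Lnorm2_leb01_pow2 (f : 2.-tuple (measurableTypeR R) -> R) :
  measurable_fun setT f ->
  ('N[leb01_pow 2]_2%:E[EFin \o f] = 'N[mu2]_2%:E[EFin \o (f \o pair_tuple)])%E.
Proof.
move=> mf; rewrite !Lnorm2E; congr (_ `^ _)%E.
have mf2 : measurable_fun setT (fun u => (f u ^+ 2)%:E).
  by apply/measurable_EFinP; exact: measurable_funX.
transitivity (\int[pushforward mu2 pair_tuple]_u (f u ^+ 2)%:E)%E.
  apply: eq_measure_integral; first exact: measurable_pair_tuple.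
  by move=> mp A mA _; exact: leb01_pow2E.
rewrite ge0_integral_pushforward//.
- exact: measurable_pair_tuple.
- by move=> u _; rewrite lee_fin sqr_ge0.
Qed.

Lemma ae_fst (Q : R -> Prop) : {ae @leb01 R, forall x, Q x} -> {ae mu2, forall z, Q z.1}.
Proof.
move=> [A [mA A0 QA]]; exists (A `*` setT); split.
- exact: measurableX.
- transitivity (@leb01 R A * @leb01 R setT)%E; first exact: product_measure1E.
  by transitivity (0 * @leb01 R setT)%E; [congr (_ * _)%E|rewrite mul0e].
- by move=> z /= Qz; split => //; apply: QA.
Qed.

Lemma ae_snd (Q : R -> Prop) : {ae @leb01 R, forall x, Q x} -> {ae mu2, forall z, Q z.2}.
Proof.
move=> [A [mA A0 QA]]; exists (setT `*` A); split.
- exact: measurableX.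
- transitivity (@leb01 R setT * @leb01 R A)%E; first exact: product_measure1E.
  by transitivity (@leb01 R setT * 0)%E; [congr (_ * _)%E|rewrite mule0].
- by move=> z /= Qz; split => //; apply: QA.
Qed.

End UnitSquare.

(** * Second-order cumulants *)

Section Cumulants.
Context (R : realType) (d : measure_display) (T : measurableType d).
Variables (P : probability T R) (X : int -> T -> @L2fun R).
Hypothesis X_random : random_elements X.
Local Notation mu2 := (@leb01 R \x @leb01 R)%E.

Lemma measurable_mixed_prod k (t : 'I_k -> int) (B : {set 'I_k}) :
  measurable_fun setT (fun z : k.-tuple (measurableTypeR R) * T => mixed_prod X t z.1 B z.2).
Proof.
rewrite /mixed_prod; under eq_fun do rewrite -big_enum/=.
apply: measurable_prod => j _.
apply: (measurableT_comp (f := fun z : T * measurableTypeR R => X (t j) z.1 z.2)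
  (g := fun z : k.-tuple (measurableTypeR R) * T => (z.2, tnth z.1 j))).
  exact: (X_random (t j)).2.
apply/measurable_fun_pairP; split; first exact: measurable_snd.
exact: (measurableT_comp (measurable_tnth j) measurable_fst).
Qed.

Lemma measurable_cumulant k (t : 'I_k -> int) :
  measurable_fun setT (cumulant P X t : k.-tuple (measurableTypeR R) -> R).
Proof.
rewrite /cumulant; under eq_fun do rewrite -big_filter.
apply: measurable_sum => nu; apply: measurable_funM => //.
under eq_fun do rewrite -big_enum/=.
apply: measurable_prod => B _.
under eq_fun do rewrite unlock.
exact: (measurable_Rintegral_snd P (measurable_mixed_prod t B)).
Qed.

Lemma measurable_sample1 t : measurable_fun setT
  (fun z : (measurableTypeR R * measurableTypeR R) * T => X t z.2 z.1.1).
Proof.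
apply: (measurableT_comp (f := fun z : T * measurableTypeR R => X t z.1 z.2)
  (g := fun z : (measurableTypeR R * measurableTypeR R) * T => (z.2, z.1.1))).
  exact: (X_random t).2.
apply/measurable_fun_pairP; split; first exact: measurable_snd.
exact: (measurableT_comp measurable_fst measurable_fst).
Qed.

Lemma measurable_sample2 t : measurable_fun setT
  (fun z : (measurableTypeR R * measurableTypeR R) * T => X t z.2 z.1.2).
Proof.
apply: (measurableT_comp (f := fun z : T * measurableTypeR R => X t z.1 z.2)
  (g := fun z : (measurableTypeR R * measurableTypeR R) * T => (z.2, z.1.2))).
  exact: (X_random t).2.
apply/measurable_fun_pairP; split; first exact: measurable_snd.
exact: (measurableT_comp measurable_snd measurable_fst).
Qed.

Lemma measurable_autocov t :
  measurable_fun setT (fun z : measurableTypeR R * measurableTypeR R =>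
    autocov P X t z.1 z.2).
Proof.
rewrite /autocov; under eq_fun do rewrite unlock.
apply: (@measurable_Rintegral_snd _ _ _ _ R P
  (fun z => X t z.2 z.1.1 * X 0 z.2 z.1.2)).
by apply: measurable_funM; [exact: measurable_sample1|exact: measurable_sample2].
Qed.

Lemma ord2_set1 (B : {set 'I_2}) : B != finset.set0 -> B != finset.setT ->
  exists j, B = [set j]%SET.
Proof.
move=> /set0Pn[j jB] /eqP BT; exists j; apply/setP => i; rewrite finset.inE.
case: eqP => [->//|/eqP ij]; apply/negbTE/negP => iB; apply: BT; apply/setP => l.
rewrite finset.in_setT; have : (l == i) || (l == j).
  by move: i j l ij {iB jB} => [[|[|//]] ?] [[|[|//]] ?] [[|[|//]] ?].
by case/orP => /eqP ->.
Qed.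

(** Every partition other than the one with a single block has a proper nonempty block, which in
    ['I_2] is a singleton; its factor is a mean, hence 0. *)
Lemma cumulant2 (t : 'I_2 -> int) (tau : 2.-tuple R) :
  (forall j, 'E_P[fun w => X (t j) w (tnth tau j)] = 0)%E ->
  cumulant P X t tau =
  fine 'E_P[fun w => (X (t ord0) w (tnth tau ord0) * X (t ord_max) w (tnth tau ord_max))%R]%E.
Proof.
move=> EX0; rewrite /cumulant.
have pT : finset.partition [set finset.setT]%SET (finset.setT : {set 'I_2}).
  apply/and3P; split.
  - by rewrite /finset.cover finset.big_set1.
  - by apply/finset.trivIsetP => A B; rewrite !finset.inE => /eqP -> /eqP ->; rewrite eqxx.
  - by rewrite finset.inE eq_sym; apply/set0Pn; exists ord0; rewrite finset.inE.
rewrite (bigD1 [set finset.setT]%SET)//= [X in _ + X]big1 ?addr0.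
  rewrite finset.cards1 /= expr0 fact0 mul1r mul1r finset.big_set1; congr (fine 'E_P[_]%E).
  apply/funext => w; rewrite /mixed_prod.
  under eq_bigl do rewrite finset.in_setT.
  by rewrite big_ord_recl big_ord1; congr (_ * X (t _) w (tnth tau _)); exact: val_inj.
move=> nu /andP[/and3P[/eqP cnu tnu n0] nuT].
suff [B Bnu BT] : exists2 B, B \in nu & B != finset.setT.
  have B0 : B != finset.set0 by apply: contraNneq n0 => <-.
  have [j Bj] := ord2_set1 B0 BT.
  rewrite [X in _ * X](bigD1 B)//= Bj /mixed_prod.
  under [fun w => \prod_(_ in _) _]eq_fun do rewrite finset.big_set1.
  by rewrite EX0 mul0r mulr0.
apply: contrapT => h; move/eqP: nuT; apply.
have nuE B : B \in nu -> B = finset.setT.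
  by move=> Bnu; apply: contrapT => /eqP BT; apply: h; exists B.
apply/setP => B; rewrite finset.inE; apply/idP/eqP => [/nuE//|->].
have : ord0 \in finset.cover nu by rewrite cnu finset.inE.
by move=> /finset.bigcupP[C Cnu _]; rewrite -(nuE _ Cnu).
Qed.

Hypothesis X_mean_zero : mean_zero P X.

Lemma cumulant_autocov (m : int) :
  {ae mu2, forall z, cumulant P X (fun i : 'I_2 => nth 0%R (rcons [tuple m] 0%R) i)
    (pair_tuple z) = autocov P X m z.1 z.2}.
Proof.
have h1 := ae_fst (X_mean_zero m); have h2 := ae_snd (X_mean_zero 0).
near=> z.
have [_ e1] : P.-integrable setT (fun w => (X m w z.1)%:E) /\
    'E_P[fun w => X m w z.1]%E = 0%E by near: z.
have [_ e2] : P.-integrable setT (fun w => (X 0 w z.2)%:E) /\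
    'E_P[fun w => X 0 w z.2]%E = 0%E by near: z.
rewrite cumulant2.
- by rewrite /autocov !(tnth_nth 0).
- move=> j; have [->|->] : j = ord0 \/ j = ord_max.
    by case: j => -[|[|//]] h; [left|right]; exact: val_inj.
  + by rewrite (tnth_nth 0).
  + by rewrite (tnth_nth 0).
Unshelve. all: end_near. Qed.

Lemma Lnorm2_cumulant_autocov (m : int) :
  ('N[leb01_pow 2]_2%:E
     [EFin \o cumulant P X (fun i : 'I_2 => nth 0%R (rcons [tuple m] 0%R) i)] =
   'N[mu2]_2%:E[EFin \o (fun z => autocov P X m z.1 z.2)])%E.
Proof.
rewrite Lnorm2_leb01_pow2; last exact: measurable_cumulant.
rewrite !Lnorm2E; congr (_ `^ _)%E; apply: ge0_ae_eq_integral => //.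
- apply/measurable_EFinP; apply: measurable_funX.
  by apply: measurableT_comp; [exact: measurable_cumulant|exact: measurable_pair_tuple].
- by apply/measurable_EFinP; apply: measurable_funX; exact: measurable_autocov.
- by move=> z _; rewrite lee_fin sqr_ge0.
- by move=> z _; rewrite lee_fin sqr_ge0.
- have := cumulant_autocov m; apply: filterS => z /= h _; congr (_ ^+ 2)%:E.
  exact: h.
Qed.

(** The lags of C(p,2) form a 1-tuple, and the second cumulant has the same norm as the
    autocovariance, so the sum in the condition bounds all symmetric partial sums. *)
Lemma autocov_summable p : cumulant_condition P X p 2 ->
  {S : R | 0 <= S & forall n, (\sum_(k <- symseq n) (1 + `|k|%N%:R ^+ p)%:E *
    'N[mu2]_2%:E[EFin \o (fun z => autocov P X k z.1 z.2)] <= S%:E)%E}.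
Proof.
move=> [_ /(_ ord0)]; set E := (esum _ _ : \bar R) => Eoo.
have E0 : (0 <= E)%E.
  apply: esum_ge0 => t _; apply: mule_ge0; last exact: Lnorm_ge0.
  by rewrite lee_fin addr_ge0// exprn_ge0// -abszE -pmulrn.
exists (fine E) => [|n]; first exact: fine_ge0.
rewrite fineK ?ge0_fin_numE//.
rewrite /E.
apply: le_trans (sum_le_esum _ (_ : uniq [seq [tuple k] | k <- symseq n])).
  rewrite [leRHS]big_map; apply: lee_sum => k _; rewrite le_eqVlt; apply/orP; left; apply/eqP.
  by rewrite Lnorm2_cumulant_autocov (tnth_nth 0) /= -abszE -pmulrn.
by rewrite map_inj_uniq ?uniq_symseq// => i j [].
Qed.

End Cumulants.

(** * Stationarity of the autocovariance *)

Section Truncation.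
Context {R : realType}.
Implicit Types (x y : R) (f g : @L2fun R).

(** The moment condition gives integrability in the sample point for almost every (tau, sigma), not
    jointly in all variables. Truncation makes every integrand bounded, so that Fubini applies;
    dominated convergence removes it afterwards. *)
Definition trunc (n : nat) x : R := Num.max (- n%:R) (Num.min n%:R x).

Lemma truncP n x : [\/ x <= - n%:R /\ trunc n x = - n%:R,
  - n%:R <= x <= n%:R /\ trunc n x = x | n%:R <= x /\ trunc n x = n%:R].
Proof.
have n0 : 0 <= n%:R :> R by [].
rewrite /trunc; case: (leP n%:R x) => nx.
  by apply: Or33; split => //; apply/max_idPr; lra.
case: (leP (- n%:R) x) => nx'; first by apply: Or32; split => //; lra.
by apply: Or31; split => //; lra.
Qed.

Lemma trunc_bound n x : `|trunc n x| <= n%:R.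
Proof.
have n0 : 0 <= n%:R :> R by [].
by rewrite ler_norml; case: (truncP n x) => -[? ->]; lra.
Qed.

Lemma trunc_le n x : `|trunc n x| <= `|x|.
Proof.
have n0 : 0 <= n%:R :> R by [].
by case: (truncP n x) => -[? ->]; rewrite ler_norml; case: (ger0P x) => ?; lra.
Qed.

Lemma trunc_lipschitz n x y : `|trunc n x - trunc n y| <= `|x - y|.
Proof.
have n0 : 0 <= n%:R :> R by [].
by case: (truncP n x) => -[? ->]; case: (truncP n y) => -[? ->];
  case: (ger0P (x - y)) => xy; rewrite ?ler_norml; try (case: ger0P); lra.
Qed.

Lemma cvg_trunc x : trunc n x @[n --> \oo] --> x.
Proof.
apply: cvg_near_cst; near=> n; have : `|x| <= n%:R by near: n; exact: nbhs_infty_ger.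
by rewrite ler_norml; case: (truncP n x) => -[? ->] //; lra.
Unshelve. all: end_near. Qed.

Lemma measurable_trunc n : measurable_fun setT (trunc n).
Proof.
apply: continuous_measurable_fun; apply: (@continuous_lipschitz _ _ 1) => x y.
by rewrite mul1r trunc_lipschitz.
Qed.

Lemma measurable_L2fun f : measurable_fun setT (f : measurableTypeR R -> R).
Proof. exact: measurable_funP. Qed.

Lemma bounded_probability_integrable d (T : measurableType d) (P : probability T R)
    (D : set T) (f : T -> R) (M : R) : measurable D ->
  measurable_fun D f -> (forall x : T, `|f x| <= M) -> P.-integrable D (EFin \o f).
Proof.
move=> mD mf fM; apply: le_integrable (finite_measure_integrable_cst P M mD) => //.
  exact/measurable_EFinP.
by move=> x _; rewrite /= lee_fin (le_trans (fM x))// ler_norm.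
Qed.

Definition trunc_mean n (A : set (measurableTypeR R)) f : R :=
  \int[@leb01 R]_(x in A) trunc n (f x).

Lemma measurable_trunc_L2fun n f :
  measurable_fun setT (fun x : measurableTypeR R => trunc n (f x)).
Proof. by apply: measurableT_comp; [exact: measurable_trunc|exact: measurable_L2fun]. Qed.

Lemma integrable_trunc_L2fun n A f : measurable A ->
  (@leb01 R).-integrable A (EFin \o (fun x : measurableTypeR R => trunc n (f x))).
Proof.
move=> mA; apply: (@bounded_probability_integrable _ _ _ _ _ n%:R) => //.
  exact: measurable_funTS (measurable_trunc_L2fun _ _).
by move=> x; exact: trunc_bound.
Qed.

Lemma trunc_mean_lipschitz n A f g e : measurable A -> 0 < e ->
  (L2dist f g < e%:E)%E -> `|trunc_mean n A f - trunc_mean n A g| <= e.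
Proof.
move=> mA e0 fge.
pose h := fun x : measurableTypeR R => f x - g x.
have mh : measurable_fun setT h by apply: measurable_funB; exact: measurable_L2fun.
have h2 : (\int[@leb01 R]_x (h x ^+ 2)%:E <= (e ^+ 2)%:E)%E.
  by apply: Lnorm2_le_integral; [exact: ltW|exact: ltW].
rewrite /trunc_mean -RintegralB//; try exact: integrable_trunc_L2fun.
have mt : measurable_fun setT (fun x : measurableTypeR R => trunc n (f x) - trunc n (g x)).
  by apply: measurable_funB; exact: measurable_trunc_L2fun.
have it : (@leb01 R).-integrable A
    (EFin \o (fun x : measurableTypeR R => trunc n (f x) - trunc n (g x))).
  have := integrableB mA (integrable_trunc_L2fun n f mA) (integrable_trunc_L2fun n g mA).
  by [].
rewrite -lee_fin EFin_normr_Rintegral//.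
apply: le_trans (le_abse_integral _ _ _) _ => //.
  by apply/measurable_EFinP; exact: measurable_funTS.
have e2 : 0 < 2 * e by rewrite mulr_gt0.
(* The L^1 norm is controlled by the L^2 norm through |h| <= h^2/(2e) + e/2, whose integral is at
   most e/2 + e/2 on a probability space. *)
apply: (@le_trans _ _ (\int[@leb01 R]_x ((2 * e)^-1 * h x ^+ 2 + e / 2)%:E)%E).
  apply: (@le_trans _ _ (\int[@leb01 R]_x `|(trunc n (f x) - trunc n (g x))%:E|)%E).
    apply: ge0_subset_integral => //.
    by apply: measurableT_comp => //; exact/measurable_EFinP.
  apply: ge0_le_integral => //.
  - by apply: measurableT_comp => //; exact/measurable_EFinP.
  - apply/measurable_EFinP; apply: measurable_funD => //; apply: measurable_funM => //.
    exact: measurable_funX.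
  - move=> x _; rewrite lee_fin (le_trans (trunc_lipschitz _ _ _))// -/(h x).
    rewrite -(ler_pM2l e2) mulrDr mulVKf ?gt_eqF//.
    rewrite -[X in _ <= X + _]real_normK ?num_real//.
    by have := sqr_ge0 (`|h x| - e); lra.
under eq_integral do rewrite EFinD EFinM.
rewrite ge0_integralD//; last 3 first.
- by move=> x _; rewrite -EFinM lee_fin mulr_ge0 ?sqr_ge0 ?invr_ge0 ?(ltW e2).
- apply/measurable_EFinP; apply: measurable_funM => //; exact: measurable_funX.
- by move=> x _; rewrite lee_fin divr_ge0 ?(ltW e0).
have -> : (\int[@leb01 R]_x (e / 2)%:E = (e / 2)%:E)%E.
  by rewrite integral_cst// -[RHS]mule1; congr (_ * _)%E; exact: (probability_setT (@leb01 R)).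
rewrite ge0_integralZl//; last 3 first.
- by apply/measurable_EFinP; exact: measurable_funX.
- by move=> x _; rewrite lee_fin sqr_ge0.
- by rewrite lee_fin invr_ge0 ltW.
apply: (@le_trans _ _ ((2 * e)^-1%:E * (e ^+ 2)%:E + (e / 2)%:E)%E).
  by apply: leeD => //; apply: lee_wpmul2l => //; rewrite lee_fin invr_ge0 ltW.
rewrite -EFinM -EFinD lee_fin.
have -> : (2 * e)^-1 * e ^+ 2 + e / 2 = e by field; rewrite gt_eqF.
by [].
Qed.

Lemma measurable_trunc_mean n A : measurable A ->
  measurable_fun setT (trunc_mean n A : @L2borel R -> R).
Proof.
move=> mA mT; apply: (measurability _ (RGenOInfty.measurableE R)) => //.
move=> _ [_ [a ->] <-]; rewrite setTI; apply: sub_sigma_algebra.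
move=> f /=; rewrite in_itv/= andbT => af.
(* Half the distance to a, because the Lipschitz bound is a weak inequality. *)
exists ((trunc_mean n A f - a) / 2); first by rewrite divr_gt0// subr_gt0.
move=> g /= fg; rewrite in_itv/= andbT.
have := trunc_mean_lipschitz n mA _ fg; rewrite divr_gt0 ?subr_gt0// => /(_ isT).
by rewrite ler_norml => /andP[_]; lra.
Qed.

Lemma trunc_mean_bound n A f : measurable A -> `|trunc_mean n A f| <= n%:R.
Proof.
move=> mA; apply: le_trans (le_normr_Rintegral mA (integrable_trunc_L2fun n f mA)) _.
apply: (@le_trans _ _ (\int[@leb01 R]_(x in A) n%:R)).
  apply: le_Rintegral => //.
  - have := integrable_abse (integrable_trunc_L2fun n f mA); by [].
  - exact: finite_measure_integrable_cst.
  - by move=> x _; exact: trunc_bound.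
rewrite Rintegral_cst// ler_piMr// -lee_fin fineK ?probability_le1//.
exact: fin_num_measure.
Qed.

End Truncation.

(** Rectangles form a pi-system that generates the product sigma-algebra, and the sets over which
    the integrals agree form a Dynkin system; the complement step uses that the integrals are
    finite. *)
Lemma ae_eq_rectangles d1 d2 (T1 : measurableType d1) (T2 : measurableType d2)
    (R : realType) (mu : {measure set (T1 * T2) -> \bar R}) (f g : T1 * T2 -> \bar R) :
  mu.-integrable setT f -> mu.-integrable setT g ->
  (forall A B, measurable A -> measurable B ->
    \int[mu]_(z in A `*` B) f z = \int[mu]_(z in A `*` B) g z)%E ->
  {ae mu, forall z, f z = g z}.
Proof.
move=> fi gi fg.
have fS D : measurable D -> mu.-integrable D f by move=> mD; exact: integrableS fi.
have gS D : measurable D -> mu.-integrable D g by move=> mD; exact: integrableS gi.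
have key D : measurable D -> (\int[mu]_(z in D) f z = \int[mu]_(z in D) g z)%E.
  pose G : set (set (T1 * T2)) := [set A `*` B | A in measurable & B in measurable].
  have GE : @measurable _ (T1 * T2)%type = <<s G >>.
    exact: measurable_prod_measurableType.
  have T0 : (\int[mu]_(z in setT) f z = \int[mu]_(z in setT) g z)%E.
    by rewrite -setXTT; exact: fg.
  move=> mD; have sD : <<s G >> D by rewrite -GE.
  move: D sD {mD}; apply: (dynkin_induction GE) => //.
  - move=> _ _ [A mA [B mB <-]] [A' mA' [B' mB' <-]]; rewrite -setXI.
    by exists (A `&` A'); [exact: measurableI|exists (B `&` B') => //; exact: measurableI].
  - by move=> _ [A mA [B mB <-]]; exact: fg.
  - move=> D mD fgD.
    have mDC : measurable (~` D) by exact: measurableC.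
    have splitD h : mu.-integrable setT h ->
        (\int[mu]_(z in setT) h z = \int[mu]_(z in D) h z + \int[mu]_(z in ~` D) h z)%E.
      move=> hi; rewrite -(setUv D) integral_setU//; first by rewrite setUv; exact: measurable_int hi.
      exact/disj_setPCl.
    have := T0; rewrite (splitD f)// (splitD g)// fgD.
    have : (\int[mu]_(z in D) g z)%E \is a fin_num by apply: integrable_fin_num => //; exact: gS.
    by move=> fin /(congr1 (fun x => x - \int[mu]_(z in D) g z)%E); rewrite ![(_ + \int[_]_(_ in ~` _) _)%E]addeC !addeK.
  - move=> F mF tF fgF; rewrite !integral_bigcup//.
    + by apply: eq_eseriesr => k _; exact: fgF.
    + by apply: gS; exact: bigcupT_measurable.
    + by apply: fS; exact: bigcupT_measurable.
have := integral_ae_eq measurableT fi (measurable_int _ gi) (fun E _ mE => key E mE).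
by apply: filterS => z /(_ I).
Qed.

Lemma bounded_Fubini d1 d2 (T1 : measurableType d1) (T2 : measurableType d2)
    (R : realType) (P1 : probability T1 R) (P2 : probability T2 R)
    (f : T1 * T2 -> R) (M : R) :
  measurable_fun setT f -> (forall z, `|f z| <= M) ->
  (\int[P1]_x \int[P2]_y (f (x, y))%:E = \int[P2]_y \int[P1]_x (f (x, y))%:E)%E.
Proof.
move=> mf fM; have fi : (P1 \x P2)%E.-integrable setT (EFin \o f).
  exact: (@bounded_probability_integrable _ _ _ (P1 \x P2)%E setT _ M).
exact: (Fubini fi).
Qed.

Lemma bounded_iterated_integral d1 d2 (T1 : measurableType d1) (T2 : measurableType d2)
    (R : realType) (P1 : probability T1 R) (P2 : probability T2 R)
    (f : T1 * T2 -> R) (M : R) :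
  measurable_fun setT f -> (forall z, `|f z| <= M) ->
  (\int[P1 \x P2]_z (f z)%:E = \int[P1]_x \int[P2]_y (f (x, y))%:E)%E.
Proof.
move=> mf fM; have fi : (P1 \x P2)%E.-integrable setT (EFin \o f).
  exact: (@bounded_probability_integrable _ _ _ (P1 \x P2)%E setT _ M).
exact/esym/(integral12_prod_meas1 fi).
Qed.

(** * Stationarity of the truncated covariances *)

Section Stationarity.
Context (R : realType) (d : measure_display) (T : measurableType d).
Variables (P : probability T R) (X : int -> T -> @L2fun R).
Hypothesis X_random : random_elements X.
Hypothesis X_stationary : strictly_stationary P X.
Local Notation mu2 := (@leb01 R \x @leb01 R)%E.
Local Notation I2 := (measurableTypeR R * measurableTypeR R)%type.

Definition trunc_prod n i j (u : I2 * T) : R :=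
  trunc n (X i u.2 u.1.1) * trunc n (X j u.2 u.1.2).

Definition trunc_cov n i j (z : I2) : R := \int[P]_w trunc_prod n i j (z, w).

Lemma measurable_trunc_prod n i j : measurable_fun setT (trunc_prod n i j).
Proof.
apply: measurable_funM.
- by apply: measurableT_comp; [exact: measurable_trunc|exact: measurable_sample1].
- by apply: measurableT_comp; [exact: measurable_trunc|exact: measurable_sample2].
Qed.

Lemma trunc_prod_bound n i j u : `|trunc_prod n i j u| <= n%:R * n%:R.
Proof. by rewrite normrM ler_pM// trunc_bound. Qed.

Lemma measurable_trunc_cov n i j : measurable_fun setT (trunc_cov n i j).
Proof. exact: (measurable_Rintegral_snd P (measurable_trunc_prod n i j)). Qed.

Lemma integrable_trunc_prod n i j z :
  P.-integrable setT (EFin \o (fun w => trunc_prod n i j (z, w))).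
Proof.
apply: (@bounded_probability_integrable _ _ _ P setT _ (n%:R * n%:R)) => //.
- by apply: (measurableT_comp (measurable_trunc_prod n i j)); exact: pair1_measurable.
- by move=> w; exact: trunc_prod_bound.
Qed.

Lemma trunc_cov_bound n i j z : `|trunc_cov n i j z| <= n%:R * n%:R.
Proof.
rewrite (le_trans (le_normr_Rintegral measurableT (integrable_trunc_prod n i j z)))//.
apply: (@le_trans _ _ (\int[P]_w (n%:R * n%:R))).
  apply: le_Rintegral => //.
  - have := integrable_abse (integrable_trunc_prod n i j z); by [].
  - exact: finite_measure_integrable_cst.
  - by move=> w _; exact: trunc_prod_bound.
rewrite Rintegral_cst// -[leRHS]mulr1 le_eqVlt; apply/orP; left; apply/eqP.
by congr (_ * _); exact: (congr1 (@fine R) (probability_setT P)).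
Qed.

Lemma integrable_trunc_cov n i j : mu2.-integrable setT (EFin \o trunc_cov n i j).
Proof.
apply: (@bounded_probability_integrable _ _ _ mu2 setT _ (n%:R * n%:R)) => //.
- exact: measurable_trunc_cov.
- by move=> z; exact: trunc_cov_bound.
Qed.

Lemma measurable_joint k (t : k.-tuple int) :
  measurable_fun setT (joint X t : T -> k.-tuple (@L2borel R)).
Proof.
apply/measurable_fun_tnthP => i.
rewrite (_ : _ \o _ = (X (tnth t i) : T -> @L2borel R)); first exact: (X_random _).1.
by apply/funext => w; rewrite /= tnth_mktuple.
Qed.

(** The expectation depends only on the joint law, and (i, j) is (i - j, 0) shifted by j. *)
Lemma stationary_trunc_mean n A B i j : measurable A -> measurable B ->
  (\int[P]_w (trunc_mean n A (X i w) * trunc_mean n B (X j w))%:E =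
   \int[P]_w (trunc_mean n A (X (i - j) w) * trunc_mean n B (X 0 w))%:E)%E.
Proof.
move=> mA mB.
pose Phi (v : 2.-tuple (@L2borel R)) : R :=
  trunc_mean n A (tnth v ord0) * trunc_mean n B (tnth v ord_max).
have mPhi : measurable_fun setT Phi.
  apply: measurable_funM.
  - apply: (measurableT_comp (f := trunc_mean n A : @L2borel R -> R)).
      exact: measurable_trunc_mean.
    exact: measurable_tnth.
  - apply: (measurableT_comp (f := trunc_mean n B : @L2borel R -> R)).
      exact: measurable_trunc_mean.
    exact: measurable_tnth.
have EPhi (t : 2.-tuple int) : (\int[P]_w (Phi (joint X t w))%:E =
    \int[pushforward P (joint X t)]_v (Phi v)%:E)%E.
  rewrite integral_pushforward//.
  - exact: measurable_joint.
  - exact/measurable_EFinP.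
  - apply: (@bounded_probability_integrable _ _ _ P setT (Phi \o joint X t) (n%:R * n%:R)) => //.
    + by apply: measurableT_comp => //; exact: measurable_joint.
    + by move=> w; rewrite /= normrM ler_pM// trunc_mean_bound.
have h := X_stationary [tuple i - j; 0] j.
have e1 : [tuple tnth [tuple i - j; 0] k + j | k < 2] = [tuple i; j].
  apply: eq_from_tnth => k; rewrite tnth_mktuple !(tnth_nth 0).
  by case: k => -[|[|//]] ? /=; rewrite ?subrK ?add0r.
have := EPhi [tuple i; j]; have := EPhi [tuple i - j; 0].
rewrite /Phi/=.
under eq_integral do rewrite !tnth_mktuple !(tnth_nth 0)/=.
move=> ->.
under eq_integral do rewrite !tnth_mktuple !(tnth_nth 0)/=.
move=> ->.
apply: eq_measure_integral => [||mj1 mj2 D mD _]; try exact: measurable_joint.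
by move: (h D mD); rewrite e1.
Qed.

(** Fubini exchanges the expectation with the integral over A x B; at a fixed sample point the
    integrand is a function of tau times a function of sigma. *)
Lemma trunc_mean_cov n A B i j : measurable A -> measurable B ->
  (\int[P]_w (trunc_mean n A (X i w) * trunc_mean n B (X j w))%:E =
   \int[mu2]_(z in A `*` B) (trunc_cov n i j z)%:E)%E.
Proof.
move=> mA mB; pose F (u : I2 * T) : R := \1_(A `*` B) u.1 * trunc_prod n i j u.
have mF : measurable_fun setT F.
  apply: measurable_funM; last exact: measurable_trunc_prod.
  apply: (measurableT_comp (f := \1_(A `*` B) : I2 -> R)) => //.
  by apply: measurable_indic; exact: measurableX.
have F1 u : `|F u| <= n%:R * n%:R.
  rewrite normrM (le_trans _ (trunc_prod_bound n i j u))// ler_piMl//.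
  by rewrite indicE; case: (_ \in _); rewrite ?normr1 ?normr0.
transitivity (\int[mu2]_z \int[P]_w (F (z, w))%:E)%E; last first.
  rewrite [RHS]integral_mkcond; apply: eq_integral => z _.
  rewrite patchE /F; case: ifPn => zAB.
    under eq_integral do rewrite indicE/= zAB mul1r.
    rewrite /trunc_cov /Rintegral fineK//.
    by apply: integrable_fin_num => //; exact: integrable_trunc_prod.
  by under eq_integral do rewrite indicE/= (negbTE zAB) mul0r; rewrite integral0.
apply/esym; apply: eq_trans (bounded_Fubini mu2 P mF F1) _.
apply: eq_integral => w _; apply/esym.
pose f1 (x : measurableTypeR R) : R := \1_A x * trunc n (X i w x).
pose f2 (x : measurableTypeR R) : R := \1_B x * trunc n (X j w x).
have mf C k : measurable C -> measurable_fun setT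
    (fun x : measurableTypeR R => \1_C x * trunc n (X k w x)).
  move=> mC; apply: measurable_funM; first exact: measurable_indic.
  exact: measurable_trunc_L2fun.
have f_bound C k x : `|\1_C x * trunc n (X k w x)| <= n%:R.
  rewrite normrM (le_trans _ (trunc_bound n (X k w x)))// ler_piMl//.
  by rewrite indicE; case: (_ \in _); rewrite ?normr1 ?normr0.
have iC C k : measurable C -> (@leb01 R).-integrable setT
    (EFin \o (fun x : measurableTypeR R => \1_C x * trunc n (X k w x))).
  move=> mC; apply: (@bounded_probability_integrable _ _ _ _ setT _ n%:R) => //.
    exact: mf.
have fE C k : measurable C -> (\int[@leb01 R]_x (\1_C x * trunc n (X k w x))%:E =
    (trunc_mean n C (X k w))%:E)%E.
  move=> mC; rewrite /trunc_mean /Rintegral fineK; last first.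
    by apply: integrable_fin_num => //; exact: integrable_trunc_L2fun.
  rewrite [RHS]integral_mkcond; apply: eq_integral => x _.
  by rewrite patchE indicE; case: ifP => _; rewrite ?mul1r ?mul0r.
have mFw : measurable_fun setT (fun z : I2 => F (z, w)).
  by apply: (measurableT_comp mF); exact: pair2_measurable.
have h := @bounded_iterated_integral _ _ _ _ R (@leb01 R) (@leb01 R)
  (fun z => F (z, w)) _ mFw (fun z => F1 (z, w)).
apply/esym; apply: (eq_trans h); apply/esym.
transitivity (\int[@leb01 R]_x ((trunc_mean n B (X j w))%:E * (f1 x)%:E))%E.
  rewrite integralZl//; last exact: iC.
  by rewrite fE// -EFinM mulrC.
apply: eq_integral => x _.
transitivity (\int[@leb01 R]_y ((f1 x)%:E * (f2 y)%:E))%E.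
  rewrite integralZl//; last exact: iC.
  by rewrite fE// muleC.
apply: eq_integral => y _; rewrite /F /f1 /f2 /trunc_prod/= -EFinM; congr EFin.
rewrite !indicE in_setX/=; case: (x \in A); case: (y \in B) => /=; ring.
Qed.

Lemma trunc_cov_stationary n i j :
  {ae mu2, forall z, trunc_cov n i j z = trunc_cov n (i - j) 0 z}.
Proof.
have := @ae_eq_rectangles _ _ _ _ R mu2 (EFin \o trunc_cov n i j)
  (EFin \o trunc_cov n (i - j) 0) (integrable_trunc_cov n i j)
  (integrable_trunc_cov n (i - j) 0).
move=> h; have {h} : {ae mu2, forall z, (EFin \o trunc_cov n i j) z =
    (EFin \o trunc_cov n (i - j) 0) z}.
  apply: h => A B mA mB.
  apply: eq_trans (esym (trunc_mean_cov n i j mA mB)) _.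
  apply: eq_trans (stationary_trunc_mean n i j mA mB) _.
  exact: trunc_mean_cov.
by apply: filterS => z /= [].
Qed.

End Stationarity.

(** * Removal of the truncation *)

Section AutocovarianceStationarity.
Context (R : realType) (d : measure_display) (T : measurableType d).
Variables (P : probability T R) (X : int -> T -> @L2fun R).
Hypothesis X_random : random_elements X.
Hypothesis X_moments : cumulant_moments P X 2.
Local Notation mu2 := (@leb01 R \x @leb01 R)%E.
Local Notation I2 := (measurableTypeR R * measurableTypeR R)%type.

Lemma integrable_sample_prod i j :
  {ae mu2, forall z, P.-integrable setT (EFin \o (fun w => X i w z.1 * X j w z.2)%R)}.
Proof.
have := ae_leb01_pow2 (X_moments (fun k : 'I_2 => nth 0 [:: i; j] k)).
apply: filterS => z /(_ finset.setT).
apply: eq_integrable => // w _; rewrite /= /mixed_prod; congr EFin.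
under eq_bigl do rewrite finset.in_setT.
by rewrite big_ord_recl big_ord1 /= !(tnth_nth 0).
Qed.

Lemma cvg_trunc_cov i j z :
  P.-integrable setT (EFin \o (fun w => X i w z.1 * X j w z.2)%R) ->
  trunc_cov P X n i j z @[n --> \oo] --> \int[P]_w (X i w z.1 * X j w z.2).
Proof.
move=> iX; have mw (f : I2 * T -> R) : measurable_fun setT f ->
    measurable_fun setT (fun w => f (z, w)).
  by move=> mf; apply: (measurableT_comp mf); exact: pair1_measurable.
apply: (@Rintegral_dominated_cvg _ _ _ P _ _ (fun w => `|X i w z.1 * X j w z.2|)).
- by move=> n; apply: mw; exact: measurable_trunc_prod.
- apply: (mw (fun u => X i u.2 u.1.1 * X j u.2 u.1.2)).
  by apply: measurable_funM; [exact: measurable_sample1|exact: measurable_sample2].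
- exact: (integrable_abse iX).
- by apply: aeW => w; apply: cvgM; exact: cvg_trunc.
- by apply: aeW => w n; rewrite /trunc_prod/= !normrM ler_pM// trunc_le.
Qed.

Hypothesis X_stationary : strictly_stationary P X.

Lemma expectation_sample_prod i j : {ae mu2, forall z,
  P.-integrable setT (EFin \o (fun w => X i w z.1 * X j w z.2)%R) /\
  \int[P]_w (X i w z.1 * X j w z.2) = autocov P X (i - j) z.1 z.2}.
Proof.
have h1 := integrable_sample_prod i j.
have h2 := integrable_sample_prod (i - j) 0.
(* One null set for all n, so that both sides go to the limit at the same point. *)
have h3 : {ae mu2, forall z, forall n, trunc_cov P X n i j z = trunc_cov P X n (i - j) 0 z}.
  by apply: ae_foralln => n; exact: trunc_cov_stationary.
near=> z.
have i1 : P.-integrable setT (EFin \o (fun w => X i w z.1 * X j w z.2)%R) by near: z.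
have i2 : P.-integrable setT (EFin \o (fun w => X (i - j) w z.1 * X 0 w z.2)%R) by near: z.
have e3 : forall n, trunc_cov P X n i j z = trunc_cov P X n (i - j) 0 z by near: z.
split=> //; rewrite /autocov unlock.
have c1 := cvg_trunc_cov i1; have c2 := cvg_trunc_cov i2.
have e : (fun n => trunc_cov P X n i j z) = (fun n => trunc_cov P X n (i - j) 0 z).
  exact/funext.
by move: c1; rewrite e => c1; exact: (cvg_unique _ c1 c2).
Unshelve. all: end_near. Qed.

End AutocovarianceStationarity.

(** * Expectation of the estimator *)

Section EstimatorComponents.
Context (R : realType) (d : measure_display) (T : measurableType d).
Variables (P : probability T R) (X : int -> T -> @L2fun R).
Local Open Scope complex_scope.

Lemma cisD (x y : R) : cis (x + y) = cis x * cis y.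
Proof.
by apply/eqP; rewrite eq_complex/= cosD sinD eqxx/= addrC [cos x * sin y]mulrC [sin x * _]mulrC.
Qed.

Lemma periodogramE (N : nat) (theta tau sigma : R) (w : T) :
  periodogram X N theta tau sigma w = ((2 * pi * N%:R)^-1)%:C *
    \sum_(t < N) \sum_(u < N) (X t%:Z w tau * X u%:Z w sigma)%:C *
      cis (- (theta * (t%:Z - u%:Z)%:~R)).
Proof.
rewrite /periodogram /fdft !big_mkord mulrACA big_distrlr/= -rmorphM -invfM.
rewrite -expr2 sqr_sqrtr; last by rewrite !mulr_ge0// pi_ge0.
congr (_ * _); apply: eq_bigr => t _; apply: eq_bigr => u _.
rewrite mulrACA -rmorphM -cisD; congr (_ * cis _).
by rewrite intrB -!pmulrn; ring.
Qed.

Definition component (im : bool) (z : R[i]) : R :=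
  if im then complex.Im z else complex.Re z.

(** The imaginary part of e^(-ix) is - sin x = cos(x + pi/2), so one real computation serves both
    coordinates. *)
Definition phase (im : bool) : R := if im then pi / 2 else 0.

Variable im : bool.
Local Notation rho := (component im).
Local Notation phi := (phase im).

Lemma componentD z w : rho (z + w) = rho z + rho w.
Proof. by rewrite /component; case: im z w => -[a b] [a' b']. Qed.

Lemma componentB z w : rho (z - w) = rho z - rho w.
Proof. by rewrite /component; case: im z w => -[a b] [a' b']. Qed.

Lemma componentZ (a : R) z : rho (a%:C * z) = a * rho z.
Proof. by rewrite /component; case: im z => -[x y]; rewrite /= mul0r ?addr0 ?subr0. Qed.

Lemma component_cis x : rho (cis (- x)) = cos (x + phi).
Proof. by rewrite /component /phase; case: im; rewrite /= ?sinN ?cosDpihalf ?cosN ?addr0. Qed.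

Lemma component_sum I (s : seq I) (z : I -> R[i]) :
  rho (\sum_(i <- s) z i) = \sum_(i <- s) rho (z i).
Proof.
have rho0 : rho 0 = 0 by have := componentZ 0 0; rewrite mulr0 mul0r.
by elim: s => [|i s IH]; rewrite ?big_nil// !big_cons componentD IH.
Qed.

Lemma estimator_component m (B : nat -> R) (K N : nat) omega tau sigma w :
  (2 <= m)%N -> 0 < B N -> 2 <= B N * K%:R -> (0 < N)%N ->
  rho (flat_top_estimator X (ramp m) B N omega tau sigma w) =
  N%:R^-1 * \sum_(t < N) \sum_(u < N)
    spectral_weight m (B N) K N omega phi (t%:Z - u%:Z) *
    (X t%:Z w tau * X u%:Z w sigma).
Proof.
move=> m2 b0 bK N0; have N0' : N%:R != 0 :> R by rewrite pnatr_eq0 -lt0n.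
have pi0 : pi != 0 :> R by rewrite gt_eqF ?pi_gt0.
(* Collects the normalisations 2 pi / N of the estimator, 1/(2 pi) of the window and 1/(2 pi N) of
   the periodogram. *)
have alg (q n S C x : R) : q != 0 -> n != 0 ->
    2 * q / n / (2 * q) * S / (2 * q * n) * (x * C) = n^-1 / n * ((2 * q)^-1 * S * C) * x.
  by move=> q0 n0; field; rewrite q0 n0.
transitivity (\sum_(1 <= s < N) \sum_(t < N) \sum_(u < N) N%:R^-1 * N%:R^-1 *
  (window_sum m (B N) K (omega - 2 * pi * s%:R / N%:R) *
   cos (2 * pi * s%:R / N%:R * (t%:Z - u%:Z)%:~R + phi)) *
  (X t%:Z w tau * X u%:Z w sigma)).
  rewrite /flat_top_estimator componentZ component_sum mulr_sumr; apply: eq_bigr => s _.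
  rewrite (window_ramp _ m2 b0 bK) componentZ periodogramE componentZ.
  rewrite !mulrA component_sum mulr_sumr; apply: eq_bigr => t _.
  rewrite component_sum mulr_sumr; apply: eq_bigr => u _.
  rewrite componentZ component_cis /window_sum.
  exact: alg.
rewrite exchange_big mulr_sumr; apply: eq_bigr => t _.
rewrite exchange_big mulr_sumr; apply: eq_bigr => u _.
by rewrite /= -mulr_suml -mulr_sumr /spectral_weight !mulrA.
Qed.

Lemma spectral_density_component omega tau sigma :
  rho (spectral_density P X omega tau sigma) =
  (2 * pi)^-1 * zsum (fun k => cos (k%:~R * omega + phi) * autocov P X k tau sigma).
Proof.
rewrite /spectral_density componentZ; congr (_ * _).
transitivity (zsum (fun k => rho (cis (- (omega * k%:~R)) * (autocov P X k tau sigma)%:C))).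
  by rewrite /component; case: im.
by congr zsum; apply/funext => k; rewrite mulrC componentZ component_cis mulrC [omega * _]mulrC.
Qed.

Lemma cexpectation_component m (B : nat -> R) (K N : nat) omega tau sigma
    (r : int -> R) :
  (2 <= m)%N -> 0 < B N -> 2 <= B N * K%:R -> (0 < N)%N ->
  (forall i j : int, P.-integrable setT (EFin \o (fun w => X i w tau * X j w sigma)) /\
     \int[P]_w (X i w tau * X j w sigma) = r (i - j)) ->
  rho (cexpectation P (flat_top_estimator X (ramp m) B N omega tau sigma)) =
  N%:R^-1 * \sum_(t < N) \sum_(u < N)
    (spectral_weight m (B N) K N omega phi (t%:Z - u%:Z) * r (t%:Z - u%:Z)).
Proof.
move=> m2 b0 bK N0 Xr.
transitivity (\int[P]_w rho (flat_top_estimator X (ramp m) B N omega tau sigma w)).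
  by rewrite /component; case: im.
under eq_Rintegral do rewrite (estimator_component _ _ _ _ m2 b0 bK N0).
have Xi (t : 'I_N * 'I_N) : P.-integrable setT
    (EFin \o (fun w => X t.1%:Z w tau * X t.2%:Z w sigma)) by exact: (Xr _ _).1.
under eq_Rintegral do rewrite pair_bigA mulr_sumr /=.
rewrite Rintegral_sum => // [|t]; last first.
  apply: (@eq_integrable _ _ _ P setT measurableT _ _ _ (integrableZl measurableT
    (N%:R^-1 * spectral_weight m (B N) K N omega phi (t.1%:Z - t.2%:Z)) (Xi t))).
  by move=> w _; rewrite /= -EFinM !mulrA.
rewrite pair_bigA mulr_sumr; apply: eq_bigr => t _ /=.
rewrite mulrA -(Xr _ _).2 -RintegralZl//; apply: eq_Rintegral => w _.
by rewrite !mulrA.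
Qed.

End EstimatorComponents.

(** * Assembly of the bound *)

Lemma ae_forall_countable d (T : measurableType d) (R : realType)
    (mu : {measure set T -> \bar R}) (I : countType) (Q : I -> T -> Prop) :
  (forall i, {ae mu, forall x, Q i x}) -> {ae mu, forall x, forall i, Q i x}.
Proof.
move=> muQ; have : {ae mu, forall x, forall n, if unpickle n is Some i then Q i x else True}.
  apply: ae_foralln => n; case: (unpickle n) => [i|]; first exact: muQ.
  exact: aeW.
by apply: filterS => x h i; have := h (pickle i); rewrite pickleK.
Qed.

Lemma normc_le_components (R : realType) (z : R[i]) :
  ComplexField.Normc.normc z <= `|component false z| + `|component true z|.
Proof.
case: z => a b /=; rewrite -[leRHS]ger0_norm ?addr_ge0// -sqrtr_sqr ler_wsqrtr//.
by rewrite sqrrD !real_normK ?num_real// addrAC lerDl mulrn_wge0// mulr_ge0.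
Qed.

(** K is the first integer above 2/b, so b K <= 2 + b <= 3, and then 2 b K <= 6 < b N. *)
Lemma bandwidth_cutoff (R : realType) (b : R) (N : nat) : 0 < b <= 1 -> 6 < b * N%:R ->
  {K : nat | 2 <= b * K%:R <= 3 & (K.*2 < N)%N}.
Proof.
move=> /andP[b0 b1] bN; exists (Num.truncn (2 / b)).+1.
all: have /truncn_itv/andP[h1 h2] : 0 <= 2 / b by rewrite divr_ge0// ltW.
all: set K := Num.truncn _ in h1 h2 *.
all: have K1 : b * K%:R <= 2 by rewrite mulrC -ler_pdivlMr.
  have K2 : 2 < b * K.+1%:R by rewrite mulrC -ltr_pdivrMr.
  by rewrite (ltW K2)/= -natr1 mulrDr mulr1; lra.
rewrite -(ltr_nat R) -(ltr_pM2l b0) -muln2 natrM -natr1; lra.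
Qed.

Theorem theorem2p1 (R : realType) (d : measure_display) (T : measurableType d)
    (P : probability T R) (X : int -> T -> @L2fun R) (B : nat -> R) (p : nat)
    (X_random : random_elements X)
    (X_stationary : strictly_stationary P X)
    (X_mean_zero : mean_zero P X)
    (B_gt0 : forall N, (0 < N)%N -> 0 < B N)
    (B_cvg0 : B N @[N --> \oo] --> (0 : R))
    (BN_cvgy : B N * N%:R @[N --> \oo] --> +oo)
    (p_ge1 : (1 <= p)%N)
    (p_cond : cumulant_condition P X p 2)
    (p_max : forall q, cumulant_condition P X q 2 -> (q <= p)%N) :
  exists lambda : R -> R,
    [/\ admissible_flat_top lambda,
        kernel_order (flat_top_kernel lambda) p &
        exists C : R, \forall N \near \oo,
          (ereal_sup (range (fun omega : R =>
             L2norm2 (fun tau sigma =>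
               (cexpectation P
                  (flat_top_estimator X lambda B N omega tau sigma)
                - spectral_density P X omega tau sigma)%R)))
           <= (C * (B N ^+ p + (B N)^-1 * N%:R^-1))%:E)%E].
Proof.
exists (ramp p.+2); split; [exact: admissible_ramp|exact: kernel_order_ramp|].
have [S S0 hS] := autocov_summable X_random X_mean_zero p_cond.
(* Pairs of times are countable, so one null set serves every N and omega. *)
have cov_ae : {ae (@leb01 R \x @leb01 R)%E, forall z, forall ij : int * int,
    P.-integrable setT (EFin \o (fun w => X ij.1 w z.1 * X ij.2 w z.2)%R) /\
    \int[P]_w (X ij.1 w z.1 * X ij.2 w z.2) = autocov P X (ij.1 - ij.2) z.1 z.2}.
  by apply: ae_forall_countable => -[i j]; exact: expectation_sample_prod p_cond.1 _ _ _.
(* Twice 17, for the real and the imaginary part; S bounds the weighted norms of the autocovariances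
   and does not involve omega. *)
exists (34 * S); near=> N.
have N0 : (0 < N)%N by near: N; exact: nbhs_infty_gt.
have b0 := B_gt0 N N0.
have b1 : B N <= 1.
  by apply: le_trans (ler_norm _) _; near: N; exact: cvgr0_norm_le.
have bN : 6 < B N * N%:R by near: N; exact: (cvgryPgt _).1.
have b01 : 0 < B N <= 1 by rewrite b0.
have [K bK KN] := bandwidth_cutoff b01 bN; have /andP[bK2 _] := bK.
set e := B N ^+ p + _.
have e0 : 0 < e by rewrite ltr_pwDl ?exprn_gt0// mulr_ge0// invr_ge0// ltW.
apply: ge_ereal_sup => _ [omega _ <-]; rewrite /L2norm2.
have -> : 34 * S * e = 34 * e * S by rewrite mulrAC.
pose h (z : measurableTypeR R * measurableTypeR R) : R := ComplexField.Normc.normc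
  (cexpectation P (flat_top_estimator X (ramp p.+2) B N omega z.1 z.2) -
   spectral_density P X omega z.1 z.2).
apply: (@Lnorm2_dominated _ _ R (@leb01 R \x @leb01 R)%E (fun k z => autocov P X k z.1 z.2)
  (fun k => 1 + `|k|%N%:R ^+ p) h) => //.
- by move=> k; exact: measurable_autocov.
- by rewrite mulr_gt0.
move: cov_ae; apply: filterS => z cov_z G hG.
have cov i j := cov_z (i, j).
have bias im : `|component im
    (cexpectation P (flat_top_estimator X (ramp p.+2) B N omega z.1 z.2) -
     spectral_density P X omega z.1 z.2)| <= 17 * e * G.
  rewrite componentB spectral_density_component.
  rewrite (@cexpectation_component _ _ _ P X im p.+2 B K N omega z.1 z.2
    (fun k => autocov P X k z.1 z.2) _ b0 bK2 N0 cov)//.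
  exact: estimator_bias.
rewrite ger0_norm; last first.
  by rewrite /h; case: (_ - _) => x y /=; exact: sqrtr_ge0.
apply: le_trans (normc_le_components _) _.
by have := bias true; have := bias false; lra.
Unshelve. all: end_near. Qed.
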